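(* Suppose the data $(\mu^a,\psi^a)_{a\in A}$ (see context) satisfy: (1) $\psi_0^a(x)=x$ for all $x\in\mathbb{R}^d$, $a\in A$, and there is $C>0$ such that $\sup_{t>0}\sup_{a\in A}\frac{\|\psi_t^a(x)-x\|}{t}\le C(1+\|x\|)$ for all $x\in\mathbb{R}^d$; (2) there is $c\ge 0$ such that $\sup_{a\in A}\|\psi_t^a(x_1)-\psi_t^a(x_2)\|\le e^{ct}\|x_1-x_2\|$ for all $t\ge 0$ and $x_1,x_2\in\mathbb{R}^d$; (3) for every $\chi\in C_c^\infty(\mathbb{R}^d)$, $\limsup_{t\downarrow 0}\sup_{a\in A}\big|\int_{\mathbb{R}^d}\frac{\chi(y)-\chi(0)}{t}\,\mu_t^a(dy)\big|<\infty$; (4) $\mu_0^a=\delta_0$ for all $a\in A$, $\lim_{t\downarrow 0}\sup_{a\in A}\int_{\mathbb{R}^d}\|y\|^p\,\mu_t^a(dy)=0$, and for every $\varepsilon>0$ there is $M>0$ such that $\sup_{a\in A}\sup_{t>0}\frac{\mu_t^a(\{y:\|y\|>M\})}{t}<\varepsilon$. Let $\mathscr{L}:D(\mathscr{L})\to C_b$ be the infinitesimal generator of the strongly continuous monotone semigroup $\mathcal{S}$, and let $D\subseteq D(\mathscr{L})$ be nonempty. Then, for every $u_0\in C_b$, the function $v:[0,\infty)\times\mathbb{R}^d\to\mathbb{R}$, $v(t,x):=(\mathcal{S}(t)u_0)(x)$, is a $D$-viscosity solution to $$\partial_tv(t,x)=\mathscr{L}v(t,x)\ \text{ for }(t,x)\in(0,\infty)\times\mathbb{R}^d,\qquad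 v(0,x)=u_0(x)\ \text{ for }x\in\mathbb{R}^d.$$
   Context: Notation. $\|\cdot\|$ is the Euclidean norm on $\mathbb{R}^d$. $C_b$ is the space of bounded continuous functions $\mathbb{R}^d\to\mathbb{R}$, $\|f\|_\infty=\sup_x|f(x)|$, and $\|f\|_{\infty,K}=\sup_{x\in K}|f(x)|$ for compact $K\subset\mathbb{R}^d$. $C_b$ carries the mixed topology; a sequence $(f_n)\subset C_b$ converges to $f\in C_b$ in the mixed topology iff $\sup_n\|f_n\|_\infty<\infty$ and $\|f_n-f\|_{\infty,K}\to 0$ for every compact $K$. Limits as $t\downarrow0$ in the mixed topology mean convergence along every sequence $t_n\downarrow0$. Data. Fix $d\in\mathbb{N}$, $p\in(1,\infty)$, $m\ge 0$ and a nonempty set $A$. $\mathcal{P}_p$ is the set of Borel probability measures on $\mathbb{R}^d$ with finite $p$-th moment, and $\mathcal{W}_p$ is the $p$-Wasserstein distance on $\mathcal{P}_p$. For each $a\in A$, $\mu^a=(\mu_t^a)_{t\ge 0}\subset\mathcal{P}_p$ and $\psi^a=(\psi_t^a)_{t\ge0}$ is a family of continuous maps $\mathbb{R}^d\to\mathbb{R}^d$ such that the Chapman–Kolmogorov equations hold: $$\int f(\psi_{s+t}^a(x)+y)\,\mu_{s+t}^a(dy)=\int\int f\big(\psi_s^a(\psi_t^a(x)+y_t)+y_s\big)\,\mu_s^a(dy_s)\,\mu_t^a(dy_t)$$ for all $s,t\ge 0$, $f\in C_b$, $x\in\mathbb{R}^d$. Operators. $\mathcal{B}_t^a(m):=\{\nu\in\mathcal{P}_p:\mathcal{W}_p(\mu_t^a,\nu)\le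 tm\}$, and for $t\ge 0$, $f\in C_b$, $x\in\mathbb{R}^d$, $$(I(t)f)(x):=\inf_{a\in A}\sup_{\nu\in\mathcal{B}_t^a(m)}\int_{\mathbb{R}^d}f(\psi_t^a(x)+z)\,\nu(dz).$$ Under hypotheses (1)–(4) of the claim, $I(t)$ maps $C_b$ to $C_b$. $\mathrm{P}_t$ ($t\ge0$) is the set of all finite subsets $\pi\subset[0,\infty)$ with $0\in\pi$ and $\max\pi=t$. For $\pi=\{t_0,\dots,t_k\}$ with $0=t_0<\dots<t_k$, $k\ge1$, $\mathcal{I}(\pi)f:=I(t_1-t_0)\cdots I(t_k-t_{k-1})f$ (composition), and $\mathcal{I}(\{0\})f:=f$. Define $(\mathcal{S}(t)f)(x):=\inf_{\pi\in\mathrm{P}_t}(\mathcal{I}(\pi)f)(x)$. Under hypotheses (1)–(4) of the claim, $\mathcal{S}$ is a strongly continuous monotone semigroup on $C_b$, i.e. each $\mathcal{S}(t):C_b\to C_b$ is (sequentially) continuous in the mixed topology, $\mathcal{S}(0)f=f$, $f\le g$ implies $\mathcal{S}(t)f\le\mathcal{S}(t)g$, $\mathcal{S}(t)\mathcal{S}(s)=\mathcal{S}(t+s)$, and $t\mapsto\mathcal{S}(t)f$ is continuous in the mixed topology for every $f\in C_b$. Generator. $\mathscr{L}f:=\lim_{t\downarrow0}\frac{\mathcal{S}(t)f-f}{t}$, with $D(\mathscr{L})$ the set of $f\in C_b$ for which this limit exists in $C_b$ with respect to the mixed topology. $D$-viscosity solutions. Let $u_0\in C_b$ and $\emptyset\ne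 D\subseteq D(\mathscr{L})$. $C_b([0,\infty)\times\mathbb{R}^d)$ is the set of bounded continuous functions on $[0,\infty)\times\mathbb{R}^d$, and $C_b^1((0,\infty)\times\mathbb{R}^d)$ is the set of bounded functions on $(0,\infty)\times\mathbb{R}^d$ with bounded continuous derivative. A function $v:[0,\infty)\times\mathbb{R}^d\to\mathbb{R}$ is a $D$-viscosity subsolution (resp. supersolution) of the initial value problem $\partial_tv(t,x)=\mathscr{L}v(t,x)$ for $(t,x)\in(0,\infty)\times\mathbb{R}^d$, $v(0,x)=u_0(x)$ for $x\in\mathbb{R}^d$, if $v\in C_b([0,\infty)\times\mathbb{R}^d)$, $v(0,\cdot)=u_0$, and for all $(t,x)\in(0,\infty)\times\mathbb{R}^d$ and all $\varphi\in C_b^1((0,\infty)\times\mathbb{R}^d)$ with $\varphi(t,\cdot)\in D$, $v(t,x)=\varphi(t,x)$ and $v\le\varphi$ (resp. $v\ge\varphi$) on $(0,\infty)\times\mathbb{R}^d$, one has $\partial_t\varphi(t,x)\le(\mathscr{L}\varphi(t,\cdot))(x)$ (resp. $\partial_t\varphi(t,x)\ge(\mathscr{L}\varphi(t,\cdot))(x)$). A $D$-viscosity solution is a function that is both a $D$-viscosity sub- and supersolution.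
   Formalization: That S is a strongly continuous monotone semigroup on C_b is taken as an explicit hypothesis, because it does not follow from (1)–(4): the law S(t)S(s)=S(t+s) can fail when m>0 and the maps ψ expand distances. *)

(* Defs.v *)
From HB Require Import structures.
From mathcomp Require Import all_boot all_order all_algebra.
From mathcomp Require Import finmap.
From mathcomp Require Import all_classical all_reals all_analysis.

Set Implicit Arguments.
Unset Strict Implicit.
Unset Printing Implicit Defensive.

Import Order.TTheory GRing.Theory Num.Theory.
Import numFieldNormedType.Exports.

Local Open Scope classical_set_scope.
Local Open Scope ring_scope.

(* The library norm on 'rV[R]_d is the max norm (same topology). *)
Definition enorm (R : realType) (d : nat) (x : 'rV[R]_d) : R :=
  Num.sqrt (\sum_(i < d) x ord0 i ^+ 2).

(* R^d with its Borel sigma-algebra; convertible to 'rV[R]_d. *)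
Definition borelRd (R : realType) (d : nat) :=
  g_sigma_algebraType (@open 'rV[R]_d).

Definition Cb (R : realType) (T : topologicalType) : set (T -> R) :=
  [set f | continuous f /\ exists M : R, forall x, `|f x| <= M].
Arguments Cb {R T}.

Section Mixed.
Context {R : realType} {d : nat}.
Local Notation E := 'rV[R]_d.

(* Sequential convergence in the mixed topology on C_b. *)
Definition mixed_cvg (fn : nat -> E -> R) (f : E -> R) : Prop :=
  (exists M : R, forall n x, `|fn n x| <= M) /\
  (forall K : set E, compact K -> {uniform K, fn @ \oo --> f}).

(* Only times t >= 0 and functions in C_b are meaningful. *)
Record strongly_continuous_monotone_semigroup
    (S : R -> (E -> R) -> E -> R) : Prop := {
  semigroup_Cb : forall (t : R) (f : E -> R), 0 <= t -> Cb f -> Cb (S t f) ;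
  semigroup_continuous : forall (t : R) (fn : nat -> E -> R) (f : E -> R), 0 <= t ->
    (forall n, Cb (fn n)) -> Cb f -> mixed_cvg fn f ->
    mixed_cvg (fun n => S t (fn n)) (S t f) ;
  semigroup_0 : forall f : E -> R, Cb f -> S 0 f = f ;
  semigroup_monotone : forall (t : R) (f g : E -> R), 0 <= t -> Cb f -> Cb g ->
    (forall x, f x <= g x) -> forall x, S t f x <= S t g x ;
  semigroup_add : forall (s t : R) (f : E -> R), 0 <= s -> 0 <= t -> Cb f ->
    S t (S s f) = S (t + s) f ;
  semigroup_strongly_continuous : forall (f : E -> R) (tn : nat -> R) (t : R), Cb f ->
    (forall n, 0 <= tn n) -> 0 <= t -> tn @ \oo --> t ->
    mixed_cvg (fun n => S (tn n) f) (S t f) }.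

Definition is_generator_value (S : R -> (E -> R) -> E -> R)
    (f g : E -> R) : Prop :=
  Cb g /\
  forall tn : nat -> R, (forall n, 0 < tn n) -> tn @ \oo --> (0 : R) ->
    mixed_cvg (fun n x => (S (tn n) f x - f x) / tn n) g.

Definition generator_domain (S : R -> (E -> R) -> E -> R) : set (E -> R) :=
  [set f | Cb f /\ exists g, is_generator_value S f g].

(* The limit is unique; the value is irrelevant off generator_domain S. *)
Definition generator (S : R -> (E -> R) -> E -> R) (f : E -> R) : E -> R :=
  get [set g | is_generator_value S f g].

End Mixed.

Section Smooth.
Context {R : realType} {d : nat}.
Local Notation E := 'rV[R]_d.

Definition partial (i : 'I_d) (f : E -> R) : E -> R := 'D_(delta_mx ord0 i) f.

Definition iter_partial (s : seq 'I_d) (f : E -> R) : E -> R :=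
  foldr partial f s.

Definition smooth (f : E -> R) : Prop :=
  forall s : seq 'I_d, continuous (iter_partial s f) /\
    forall i x, derivable (iter_partial s f) x (delta_mx ord0 i).

Definition Cc_infty : set (E -> R) :=
  [set f | smooth f /\ compact (closure [set x | f x != 0])].

End Smooth.

Section Wasserstein.
Context {R : realType} {d : nat}.
Local Notation E := 'rV[R]_d.
Local Notation B := (borelRd R d).

Definition finite_moment (p : R) (nu : probability B R) : Prop :=
  (\int[nu]_y (enorm (y : E) `^ p)%:E < +oo)%E.

Definition coupling (mu nu : probability B R) :
    set (probability (B * B)%type R) :=
  [set gamma | forall A : set B, measurable A ->
     gamma (A `*` setT) = mu A /\ gamma (setT `*` A) = nu A].

Definition wasserstein (p : R) (mu nu : probability B R) : \bar R :=
  ((ereal_inf [set (\int[gamma]_z (enorm ((z.1 : E) - (z.2 : E)) `^ p)%:E)%E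
              | gamma in coupling mu nu]) `^ p^-1)%E.

End Wasserstein.

Section Operators.
Context {R : realType} {d : nat} (p m : R) {A : Type}.
Local Notation E := 'rV[R]_d.
Local Notation B := (borelRd R d).
Variables (mu : A -> R -> probability B R) (psi : A -> R -> E -> E).

Definition wball (a : A) (t : R) : set (probability B R) :=
  [set nu | finite_moment p nu /\ (wasserstein p (mu a t) nu <= (t * m)%:E)%E].

(* Inf and sup are of bounded nonempty sets of reals when f \in C_b. *)
Definition Iop (t : R) (f : E -> R) : E -> R := fun x =>
  inf [set sup [set \int[nu]_z f (psi a t x + (z : E)) | nu in wball a t]
      | a in [set: A]].

Definition partition_upto (t : R) : set {fset R} :=
  [set pi : {fset R} | [/\ 0 \in pi, t \in pi &
                          forall s, s \in pi -> 0 <= s <= t]].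

Fixpoint Ichain (s : seq R) (f : E -> R) : E -> R :=
  match s with
  | t0 :: ((t1 :: _) as s') => Iop (t1 - t0) (Ichain s' f)
  | _ => f
  end.

Definition Ipart (pi : {fset R}) (f : E -> R) : E -> R :=
  Ichain (sort <=%R (enum_fset pi)) f.

(* The semigroup law S(t) S(s) = S(t + s) can fail when m > 0 and psi expands
   distances (psi the flow of a bounded b with b(x) = x near 0, mu = delta_0):
   theorems on the semigroup Sop take it as a hypothesis. *)
Definition Sop (t : R) (f : E -> R) : E -> R := fun x =>
  inf [set Ipart pi f x | pi in partition_upto t].

End Operators.

Section Viscosity.
Context {R : realType} {d : nat}.
Local Notation E := 'rV[R]_d.

(* C_b([0,oo) x R^d); values at negative times are irrelevant. *)
Definition Cb_time_space : set (R * E -> R) :=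
  [set v : R * E -> R | {within [set z : R * E | 0 <= z.1], continuous v} /\
     exists M : R, forall z : R * E, 0 <= z.1 -> `|v z| <= M].

(* C_b^1((0,oo) x R^d): the total derivative z |-> 'd phi z is bounded and
   continuous in operator norm on (0,oo) x R^d. *)
Definition Cb1_time_space : set (R * E -> R) :=
  [set phi : R * E -> R | [/\ exists M : R, forall z : R * E, 0 < z.1 -> `|phi z| <= M,
    forall z : R * E, 0 < z.1 -> differentiable phi z,
    exists M : R, forall z : R * E, 0 < z.1 ->
      forall h : R * E, `|'d phi z h| <= M * `|h|
  & forall z : R * E, 0 < z.1 -> forall e : R, 0 < e ->
      \forall w \near z, forall h : R * E,
        `|'d phi w h - 'd phi z h| <= e * `|h| ]].

Definition time_derivative (phi : R * E -> R) (t : R) (x : E) : R :=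
  derive1 (fun s : R => phi (s, x)) t.

Variables (L : (E -> R) -> E -> R) (D : set (E -> R)) (u0 : E -> R).

Definition viscosity_subsolution (v : R * E -> R) : Prop :=
  [/\ Cb_time_space v,
      forall x, v (0, x) = u0 x &
      forall (t : R) (x : E) (phi : R * E -> R), 0 < t ->
        Cb1_time_space phi -> D (fun y => phi (t, y)) ->
        v (t, x) = phi (t, x) ->
        (forall z : R * E, 0 < z.1 -> v z <= phi z) ->
        time_derivative phi t x <= L (fun y => phi (t, y)) x].

Definition viscosity_supersolution (v : R * E -> R) : Prop :=
  [/\ Cb_time_space v,
      forall x, v (0, x) = u0 x &
      forall (t : R) (x : E) (phi : R * E -> R), 0 < t ->
        Cb1_time_space phi -> D (fun y => phi (t, y)) ->
        v (t, x) = phi (t, x) ->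
        (forall z : R * E, 0 < z.1 -> phi z <= v z) ->
        L (fun y => phi (t, y)) x <= time_derivative phi t x].

Definition viscosity_solution (v : R * E -> R) : Prop :=
  viscosity_subsolution v /\ viscosity_supersolution v.

End Viscosity.

(* Main.v *)
Require Import Defs.
From HB Require Import structures.
From mathcomp Require Import all_boot all_order all_algebra.
From mathcomp Require Import finmap.
From mathcomp Require Import all_classical all_reals all_analysis.
From mathcomp Require Import measurable_realfun.
From mathcomp Require Import ring lra.

Set Implicit Arguments.
Unset Strict Implicit.
Unset Printing Implicit Defensive.

Import Order.TTheory GRing.Theory Num.Theory.
Import numFieldNormedType.Exports.

Local Open Scope classical_set_scope.
Local Open Scope ring_scope.

(** Let [S t := Sop p m mu psi t] and [v (t, x) := S t u0 x], and suppose that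
    [phi] touches [v] from above at [(t, x)].  Dynamic programming and
    monotonicity give
      [phi (t, x) = S h (v (t - h, _)) x <= S h (phi (t - h, _)) x],
    and if one could replace [phi (t - h, _)] by
    [phi (t, _) - h * d_t phi (t, x)] inside [S h] at the price of [o(h)], then
    dividing by [h] and letting [h] tend to 0 would give
    [d_t phi (t, x) <= L (phi (t, _)) x].  The case of contact from below is
    symmetric.  Constants pass through [S h]; the difficulty is that the
    replacement is only accurate to [o(h)] for [y] near [x], while [S h] is a
    nonlinear (inf-sup) and nonlocal operator.

    The replacement is justified by a Lyapunov function.  With
    [q y := saturate (y - x)], where [saturate u = |u|^2 / (1 + |u|^2)], the
    error of the time expansion is at most [h * (e + b * q y)] for every [y]
    ([time_expansion]), and [q] has the property that one short step of the scheme,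
    from any point, with any control and any measure in the Wasserstein ball,
    raises its expectation by at most [K] times the length of the step
    ([saturate_one_step]).  Summing over a partition, an inequality
    [f <= g + c + beta * q] yields [S h f x <= S h g x + c + beta * K * h]
    ([Sop_comparison]); for [beta = h * b] the last term is of order [h^2].

    The one-step bound has three sources.  The drift of size [t (1 + |y|)] costs
    [O(t)] because the gradient of [q] decays fast enough at infinity
    ([saturate_drift]).  Passing from a measure in the ball to its centre costs
    [O(t)] because [q] is Lipschitz ([wasserstein_lipschitz]).  For the centre
    [mu a t], concavity of [s / (1 + s)] bounds the increments of [q] by a linear
    combination of [z_i k(z)] and [1 - k(z)], where [k] is a smooth cut-off, with
    coefficients bounded uniformly in the starting point
    ([saturate_increment]); the growth condition, applied to the test functions
    [z_i k(z)] and [k], makes their expectations [O(t)].  The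
    cut-off is a product of one-dimensional bumps built from [exp (- 1 / x)].

    Comparisons are made between bounded Lipschitz functions, a class that is
    stable under the scheme and contains the time slices of the test
    functions. *)

(** * Smooth bump functions on the line *)

Section SmoothLine.
Context {R : realType}.
Implicit Types (f g : R -> R) (P : {poly R}) (n : nat).

(** Smoothness phrased by recursion on the order, which makes stability under
    the algebraic operations a plain induction, with no Leibniz formula. *)
Fixpoint ntimes_derivable n f : Prop :=
  if n is n'.+1 then
    exists2 f', (forall x, is_derive x (1 : R) f (f' x)) & ntimes_derivable n' f'
  else True.

Definition smooth1 f := forall n, ntimes_derivable n f.

Lemma ntimes_derivableW n f : ntimes_derivable n.+1 f -> ntimes_derivable n f.
Proof.
elim: n f => [//|n IHn] f [f' df f'n]; exists f' => //; exact: IHn.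
Qed.

Lemma ntimes_derivable_cst n (c : R) : ntimes_derivable n (cst c).
Proof.
elim: n c => [//|n IHn] c; exists (cst 0); last exact: IHn.
by move=> x; exact: is_derive_cst.
Qed.

Lemma ntimes_derivableD n f g : ntimes_derivable n f -> ntimes_derivable n g ->
  ntimes_derivable n (f \+ g).
Proof.
elim: n f g => [//|n IHn] f g [f' df f'n] [g' dg g'n].
exists (f' \+ g'); last exact: IHn.
by move=> x; exact: is_deriveD.
Qed.

Lemma ntimes_derivableM n f g : ntimes_derivable n f -> ntimes_derivable n g ->
  ntimes_derivable n (f \* g).
Proof.
elim: n f g => [//|n IHn] f g fn gn.
have [f' df f'n] := fn; have [g' dg g'n] := gn.
exists ((f \* g') \+ (g \* f')); first by move=> x; exact: is_deriveM.
by apply: ntimes_derivableD; apply: IHn => //; exact: ntimes_derivableW.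
Qed.

Lemma ntimes_derivable_affine n f (a c : R) : ntimes_derivable n f ->
  ntimes_derivable n (fun x => f (a * x + c)).
Proof.
elim: n f => [//|n IHn] f [f' df f'n].
exists ((fun x => f' (a * x + c)) \* cst a).
  move=> x; apply: (@is_derive1_comp _ f (fun x => a * x + c)) => //.
  by apply: is_derive_eq; rewrite addr0 /GRing.scale /= mulr1 ?mulr0 ?addr0.
by apply: ntimes_derivableM; [exact: IHn|exact: ntimes_derivable_cst].
Qed.

Lemma smooth1_derivable f x : smooth1 f -> derivable f x 1.
Proof. by move=> /(_ 1%N) [f' df _]; exact: ex_derive. Qed.

Lemma smooth1_derive1 f : smooth1 f -> smooth1 f^`()%classic.
Proof.
move=> fs n; have [f' df f'n] := fs n.+1.
suff -> : f^`()%classic = f' by [].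
by apply/funext => x; rewrite derive1E; exact: derive_val.
Qed.

Lemma smooth1M f g : smooth1 f -> smooth1 g -> smooth1 (f \* g).
Proof. by move=> fs gs n; exact: ntimes_derivableM. Qed.

Lemma smooth1_id : smooth1 (id : R -> R).
Proof.
case=> [//|n]; exists (cst 1); last exact: ntimes_derivable_cst.
by move=> x; exact: is_derive_id.
Qed.

(** The space of functions [P(1/x) exp(-1/x)] on the positive half-line,
    extended by zero: it is stable under differentiation, and every one of its
    members is flat at the origin. *)
Definition flat P (x : R) : R :=
  if 0 < x then P.[x^-1] * expR (- x^-1) else 0.

Lemma horner_le_expR P :
  exists2 C : R, 0 <= C & forall u, 0 <= u -> `|P.[u]| <= C * expR u.
Proof.
have pow_le n (u : R) : 0 <= u -> u ^+ n <= n`!%:R * expR u.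
  case: n => [|n] u0; first by rewrite expr0 mul1r -expR0 ler_expR.
  have := expR_ge1Dxn n u0; rewrite addrC -lerBrDr => h.
  rewrite -ler_pdivrMl ?ltr0n ?fact_gt0// mulrC (le_trans h)//.
  by rewrite gerBl.
exists (\sum_(i < size P) `|P`_i| * i`!%:R); first by apply: sumr_ge0 => i _; rewrite mulr_ge0.
move=> u u0; rewrite horner_coef (le_trans (ler_norm_sum _ _ _))// mulr_suml.
apply: ler_sum => i _; rewrite normrM -mulrA ler_wpM2l//.
by rewrite ger0_norm ?exprn_ge0// pow_le.
Qed.

Lemma flat_le P : exists2 C : R, 0 <= C & forall x, `|flat P x| <= C * `|x|.
Proof.
have [C C0 PC] := horner_le_expR ('X * P); exists C => // x.
rewrite /flat; case: ifPn => x0; last by rewrite normr0 mulr_ge0.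
have xi0 : 0 <= x^-1 by rewrite invr_ge0 ltW.
have := PC _ xi0; rewrite hornerM hornerX !normrM (ger0_norm xi0).
rewrite (gtr0_norm x0) (gtr0_norm (expR_gt0 _)) expRN => h.
rewrite ler_pdivrMr ?expR_gt0// -mulrA mulrCA.
by rewrite -ler_pdivrMl.
Qed.

(** At the origin the difference quotient of [flat P] is [flat ('X * P)], which
    tends to 0 by [flat_le]. *)
Lemma is_derive_flat P x : is_derive x (1 : R) (flat P) (flat ('X^2 * (P - P^`())) x).
Proof.
have [x0|x0|->] := ltgtP x 0.
- rewrite /flat ltNge (ltW x0)/=.
  apply: (@near_eq_is_derive _ _ _ (cst 0)).
  near=> y; rewrite ltNge ltW//; near: y; exact: lt_nbhsl.
- have dV : is_derive x (1 : R) (fun y => y^-1) (- x ^- 2).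
    apply: is_derive_eq; first by apply: is_deriveV; rewrite ?gt_eqF.
    by rewrite /GRing.scale/= mulr1.
  have dP := @is_derive1_comp _ (horner P) _ _ _ _ (is_derive_poly _ _) dV.
  have dN : is_derive x (1 : R) (fun y => - y^-1) (x ^- 2).
    by apply: is_derive_eq; rewrite opprK.
  have dE := @is_derive1_comp _ expR _ _ _ _ (is_derive_expR _) dN.
  apply: (@near_eq_is_derive _ _ _ ((horner P \o (fun y => y^-1)) \* (expR \o (fun y => - y^-1)))).
    near=> y; rewrite /flat ifT; first by [].
    by near: y; exact: lt_nbhsr.
  apply: (is_derive_eq (is_deriveM dP dE)).
  rewrite /flat x0 !hornerE.
  change (P.[x^-1] * (expR (- x^-1) * x ^- 2) +
    expR (- x^-1) * (P^`().[x^-1] * - x ^- 2) =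
    x^-1 ^+ 2 * (P.[x^-1] - P^`().[x^-1]) * expR (- x^-1)).
  by rewrite -exprVn; ring.
- rewrite /flat ltxx.
  have h0 : h^-1 *: ((flat P \o shift (0 : R)) (h *: (1 : R)) - flat P 0)
      @[h --> 0^'] --> (0 : R).
    have [C C0 PC] := flat_le ('X * P).
    apply/cvgr0Pnorm_le => e e0; near=> h.
    have hn0 : h != 0 by near: h; exact: nbhs_dnbhs_neq.
    rewrite /= addr0 /flat ltxx subr0 /GRing.scale/= mulr1.
    have -> : (h^-1 * (if 0 < h then P.[h^-1] * expR (- h^-1) else 0)) = flat ('X * P) h.
      by rewrite /flat; case: ifP => _; rewrite ?mulr0// hornerM hornerX mulrA.
    rewrite (le_trans (PC _))//.
    have : `|h| <= e / (C + 1).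
      near: h; apply: dnbhs0_le; rewrite divr_gt0// ltr_wpDl//.
    rewrite ler_pdivlMr; last by rewrite ltr_wpDl.
    by apply: le_trans; rewrite mulrC ler_wpM2l// lerDl.
  apply: DeriveDef; first by apply/cvg_ex; exists 0.
  exact/cvg_lim.
Unshelve. all: by end_near. Qed.

Lemma smooth1_flat P : smooth1 (flat P).
Proof.
move=> n; elim: n P => [//|n IHn] P.
by exists (flat ('X^2 * (P - P^`()))); [exact: is_derive_flat|exact: IHn].
Qed.

(** The factor [expR 2] normalises the value at the origin to 1. *)
Definition bump (x : R) : R := expR 2 * (flat 1 (x + 1) * flat 1 (- x + 1)).

Lemma smooth1_bump : smooth1 bump.
Proof.
move=> n; apply: (@ntimes_derivableM n (cst (expR 2))).
  exact: ntimes_derivable_cst.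
apply: (@ntimes_derivableM n (fun x => flat 1 (x + 1)) (fun x => flat 1 (- x + 1))).
- rewrite (_ : (fun x => _) = fun x => flat 1 (1 * x + 1)).
    by apply: ntimes_derivable_affine; exact: smooth1_flat.
  by apply/funext => x; rewrite mul1r.
- rewrite (_ : (fun x => _) = fun x => flat 1 (-1 * x + 1)).
    by apply: ntimes_derivable_affine; exact: smooth1_flat.
  by apply/funext => x; rewrite mulN1r.
Qed.

Lemma bump_out x : 1 <= `|x| -> bump x = 0.
Proof.
rewrite ler_normr => /orP[x1|x1]; rewrite /bump /flat.
  by rewrite [X in _ * (_ * X)]ifF ?mulr0//; apply/negbTE; rewrite -leNgt; lra.
by rewrite ifF ?mul0r ?mulr0//; apply/negbTE; rewrite -leNgt; lra.
Qed.

Lemma bump_in x : `|x| < 1 -> bump x = expR (- (2 * x ^+ 2 / (1 - x ^+ 2))).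
Proof.
rewrite ltr_norml => /andP[x1 x2]; rewrite /bump /flat !ifT; [|lra|lra].
rewrite !hornerC !mul1r -!expRD; congr expR; field.
by apply/and3P; split; rewrite gt_eqF; nra.
Qed.

Lemma bump_ge0 x : 0 <= bump x.
Proof.
have [x1|x1] := leP 1 `|x|; first by rewrite bump_out.
by rewrite bump_in// expR_ge0.
Qed.

Lemma bump0 : bump 0 = 1.
Proof. by rewrite bump_in ?normr0// expr0n/= mulr0 mul0r oppr0 expR0. Qed.

(** A quadratic bound from above makes [1 - bump] control second moments. It
    follows from [1 + u <= expR u] at [u = 2 x^2 / (1 - x^2)]; the constant 2/3
    is the one for which the resulting bound [1 / (1 + 2 x^2)] still lies below
    the parabola at [x = 1] and [x = -1]. *)
Lemma bump_le x : `|x| <= 1 -> bump x <= 1 - 2 / 3 * x ^+ 2.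
Proof.
move=> x1; have x21 : x ^+ 2 <= 1 by rewrite -real_normK ?num_real// expr_le1.
have [x1'|x1'] := leP 1 `|x|; first by rewrite bump_out//; lra.
have x21' : x ^+ 2 < 1 by rewrite -real_normK ?num_real// expr_lt1.
have x20 := sqr_ge0 x.
rewrite bump_in// expRN; set u := 2 * x ^+ 2 / _.
have u0 : 2 * x ^+ 2 <= u by rewrite /u ler_pdivlMr ?subr_gt0//; nra.
have h := expR_ge1Dx u.
rewrite invf_ple ?posrE ?expR_gt0//; last by lra.
rewrite (le_trans _ h)// -[leLHS]mul1r ler_pdivrMr; last by lra.
by set X := x ^+ 2 in u u0 h x20 x21 x21' *; nra.
Qed.

Lemma bump_le1 x : bump x <= 1.
Proof.
have [x1|x1] := leP 1 `|x|; first by rewrite bump_out.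
by have := bump_le (ltW x1); have := sqr_ge0 x; lra.
Qed.

End SmoothLine.

(** * Compactly supported smooth functions of product form *)

Section ProductFunctions.
Context {R : realType} {d : nat}.
Local Notation E := 'rV[R]_d.
Implicit Types (F : 'I_d -> R -> R) (z : E).

Definition prodfun F z : R := \prod_i F i (z ord0 i).

Lemma continuous_prodfun F : (forall i, smooth1 (F i)) -> continuous (prodfun F).
Proof.
move=> Fs; rewrite /prodfun; elim: (index_enum _) => [|i r IHr].
  rewrite (_ : (fun z => _) = cst 1); first exact: cst_continuous.
  by apply/funext => z; rewrite big_nil.
rewrite (_ : (fun z => _) = fun z : E =>
    F i (z ord0 i) * \prod_(j <- r) F j (z ord0 j)); last first.
  by apply/funext => z; rewrite big_cons.
move=> z; apply: continuousM; last exact: IHr.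
apply: (@continuous_comp _ _ _ (fun z : E => z ord0 i) (F i)); first exact: coord_continuous.
exact/differentiable_continuous/derivable1_diffP/smooth1_derivable.
Qed.

Lemma is_derive_prodfun F i z : (forall j, smooth1 (F j)) ->
  is_derive z (delta_mx ord0 i : E) (prodfun F)
    (prodfun (fun j => if j == i then (F i)^`()%classic else F j) z).
Proof.
move=> Fs; have dFi := @smooth1_derivable _ _ (z ord0 i) (Fs i).
have lim_quot : h^-1 *: ((prodfun F \o shift z) (h *: delta_mx ord0 i) - prodfun F z)
    @[h --> 0^'] -->
  prodfun (fun j => if j == i then (F i)^`()%classic else F j) z.
  rewrite [X in _ --> X](_ : _ = \prod_(j | j != i) F j (z ord0 j) *
      (F i)^`()%classic (z ord0 i)); last first.
    rewrite /prodfun (bigD1 i)//= eqxx mulrC; congr (_ * _).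
    by apply: eq_bigr => j /negPf ->.
  rewrite (_ : (fun h : R => _) = fun h : R => \prod_(j | j != i) F j (z ord0 j) *
      (h^-1 *: ((F i \o shift (z ord0 i)) (h *: (1 : R)) - F i (z ord0 i)))).
    by apply: cvgMr; rewrite derive1E; exact: dFi.
  apply/funext => h; rewrite /= /prodfun (bigD1 i)//= [in X in _ - X](bigD1 i)//=.
  rewrite !mxE !eqxx /= /GRing.scale /=.
  under eq_bigr => j /negPf ji do rewrite !mxE ji andbF mulr0 add0r.
  by rewrite -mulrBl; ring.
apply: DeriveDef; first by apply/cvg_ex; eexists; exact: lim_quot.
exact/cvg_lim.
Qed.

Lemma smooth_prodfun F : (forall i, smooth1 (F i)) -> smooth (prodfun F).
Proof.
move=> Fs s.
have [G Gs ->] : exists2 G, (forall i, smooth1 (G i)) & iter_partial s (prodfun F) = prodfun G.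
  elim: s => [|i s [G Gs IHs]]; first by exists F.
  exists (fun j => if j == i then (G i)^`()%classic else G j).
    by move=> j; case: ifP => _ //; exact: smooth1_derive1.
  rewrite /= IHs; apply/funext => z; rewrite /partial.
  exact: (@derive_val _ _ _ _ _ _ _ (is_derive_prodfun i z Gs)).
split; first exact: continuous_prodfun.
by move=> i x; exact: (@ex_derive _ _ _ _ _ _ _ (is_derive_prodfun i x Gs)).
Qed.

Lemma Cc_infty_prodfun F : (forall i, smooth1 (F i)) ->
  (forall i x, 1 <= `|x| -> F i x = 0) -> Cc_infty (prodfun F).
Proof.
move=> Fs F0; split; first exact: smooth_prodfun.
pose K : set E := [set z | forall i, `[-1, 1]%classic (z ord0 i)].
have Kc : compact K.
  apply: (@rV_compact _ _ (fun=> `[(-1 : R), 1]%classic)) => i.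
  exact: segment_compact.
have Kcl : closed K.
  have hE : hausdorff_space E by exact: norm_hausdorff.
  exact: (@compact_closed E K hE Kc).
apply: (subclosed_compact _ Kc); first exact: closed_closure.
rewrite closureE; apply: smallest_sub => // y /= Fy i.
suff : -1 <= y ord0 i <= 1 by rewrite /= in_itv.
rewrite -ler_norml leNgt; apply: contra_neqN Fy => yi.
by rewrite /prodfun (bigD1 i)//= F0 ?mul0r// ltW.
Qed.

(** Its complement [1 - cutoff] dominates, up to a constant, the minimum of 1
    and the squared norm, so its expectation controls both the second moment
    near the origin and the tail. *)
Definition cutoff : E -> R := prodfun (fun=> bump).

(** [z_i * cutoff z], written in product form so that smoothness and compact
    support come from the results on products. *)
Definition cutcoord (i : 'I_d) : E -> R :=
  prodfun (fun j => if j == i then id \* bump else bump).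

Lemma Cc_infty_cutoff : Cc_infty cutoff.
Proof.
by apply: Cc_infty_prodfun => [i|i x]; [exact: smooth1_bump|exact: bump_out].
Qed.

Lemma Cc_infty_cutcoord i : Cc_infty (cutcoord i).
Proof.
apply: Cc_infty_prodfun => j; case: ifP => _; try exact: smooth1_bump.
- by apply: smooth1M; [exact: smooth1_id|exact: smooth1_bump].
- by move=> x x1 /=; rewrite bump_out ?mulr0.
- exact: bump_out.
Qed.

Lemma cutcoordE i z : cutcoord i z = z ord0 i * cutoff z.
Proof.
rewrite /cutcoord /cutoff /prodfun (bigD1 i)//= eqxx /= [in RHS](bigD1 i)//= -mulrA.
by congr (_ * (_ * _)); apply: eq_bigr => j /negPf ->.
Qed.

Lemma cutoff_ge0 z : 0 <= cutoff z.
Proof. by apply: prodr_ge0 => i _; exact: bump_ge0. Qed.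

Lemma cutoff_le1 z : cutoff z <= 1.
Proof. by apply: prodr_ile1 => i _; rewrite bump_ge0 bump_le1. Qed.

Lemma cutoff0 : cutoff 0 = 1.
Proof. by rewrite /cutoff /prodfun big1// => i _; rewrite mxE bump0. Qed.

Lemma cutoff_out z i : 1 <= `|z ord0 i| -> cutoff z = 0.
Proof.
by move=> zi; rewrite /cutoff /prodfun (bigD1 i)//= bump_out// mul0r.
Qed.

Lemma cutoff_le z i : `|z ord0 i| <= 1 -> cutoff z <= 1 - 2 / 3 * z ord0 i ^+ 2.
Proof.
move=> zi; rewrite (le_trans _ (bump_le zi))// /cutoff /prodfun (bigD1 i)//=.
by rewrite ler_piMr ?bump_ge0// prodr_ile1// => j _; rewrite bump_ge0 bump_le1.
Qed.

Lemma continuous_cutoff : continuous cutoff.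
Proof. by apply: continuous_prodfun => i; exact: smooth1_bump. Qed.

Lemma continuous_cutcoord i : continuous (cutcoord i).
Proof.
apply: continuous_prodfun => j; case: ifP => _; last exact: smooth1_bump.
by apply: smooth1M; [exact: smooth1_id|exact: smooth1_bump].
Qed.

Lemma cutcoord_le1 i z : `|cutcoord i z| <= 1.
Proof.
have [zi|zi] := leP 1 `|z ord0 i|; rewrite cutcoordE.
  by rewrite (cutoff_out zi) mulr0 normr0.
by rewrite normrM (ger0_norm (cutoff_ge0 z)) mulr_ile1 ?cutoff_le1 ?cutoff_ge0// ltW.
Qed.

End ProductFunctions.

(** * The saturated squared norm *)

Section SaturatedNorm.
Context {R : realType} {d : nat}.
Local Notation E := 'rV[R]_d.
Implicit Types (u v e z : E).

Definition sqnorm u : R := \sum_i u ord0 i ^+ 2.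
Definition dotmul u v : R := \sum_i u ord0 i * v ord0 i.

Lemma sqnorm_ge0 u : 0 <= sqnorm u.
Proof. by apply: sumr_ge0 => i _; exact: sqr_ge0. Qed.

Lemma enorm_ge0 u : 0 <= enorm u. Proof. exact: sqrtr_ge0. Qed.

Lemma sqr_enorm u : enorm u ^+ 2 = sqnorm u.
Proof. by rewrite sqr_sqrtr// sqnorm_ge0. Qed.

Lemma sqnorm_coord u i : u ord0 i ^+ 2 <= sqnorm u.
Proof.
by rewrite /sqnorm (bigD1 i)//= lerDl sumr_ge0// => j _; exact: sqr_ge0.
Qed.

Lemma enorm0 : enorm (0 : E) = 0.
Proof.
by rewrite /enorm big1 ?sqrtr0// => i _; rewrite mxE expr0n.
Qed.

Lemma enormN u : enorm (- u) = enorm u.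
Proof.
by congr Num.sqrt; apply: eq_bigr => i _; rewrite mxE sqrrN.
Qed.

Lemma sqnormD u e : sqnorm (u + e) = sqnorm u + (2 * dotmul u e + sqnorm e).
Proof.
rewrite /sqnorm /dotmul mulr_sumr -!big_split/=; apply: eq_bigr => i _.
by rewrite mxE; ring.
Qed.

(** Young's inequality, used in place of Cauchy-Schwarz. *)
Lemma dotmul_le u e (l : R) : 0 < l ->
  2 * dotmul u e <= l * sqnorm u + sqnorm e / l.
Proof.
move=> l0; rewrite /sqnorm /dotmul !mulr_sumr mulr_suml -big_split/=.
apply: ler_sum => i _; set a := u _ _; set b := e _ _.
have -> : l * a ^+ 2 + b ^+ 2 / l = (l * a - b) ^+ 2 / l + 2 * (a * b).
  by field; rewrite gt_eqF.
by rewrite lerDr divr_ge0 ?sqr_ge0// ltW.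
Qed.

Lemma enorm_le_norm u : enorm u <= (d%:R + 1) * `|u|.
Proof.
have n0 : 0 <= (d%:R + 1) * `|u| by rewrite mulr_ge0// addr_ge0.
rewrite -(ger0_norm n0) -sqrtr_sqr ler_wsqrtr//.
apply: (@le_trans _ _ (\sum_(i < d) `|u| ^+ 2)).
  apply: ler_sum => i _; rewrite -[leLHS]real_normK ?num_real// lerXn2r ?nnegrE//.
  by rewrite [leRHS]/Num.norm /= mx_normrE; apply/bigmax_geP; right; exists (ord0, i).
rewrite sumr_const card_ord -[leLHS]mulr_natl exprMn ler_wpM2r ?sqr_ge0//.
have : (0 : R) <= d%:R by []. nra.
Qed.

Lemma norm_le_enorm u : `|u| <= enorm u.
Proof.
rewrite [leLHS]/Num.norm /= mx_normrE; apply: bigmax_le => [|[i j] _ /=].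
  exact: enorm_ge0.
by rewrite ord1 -sqrtr_sqr ler_wsqrtr// sqnorm_coord.
Qed.

(** A bounded substitute for the squared norm. Since [s / (1 + s)] is concave,
    its upper Taylor estimate [saturateD] of order one has no remainder. *)
Definition saturate u : R := sqnorm u / (1 + sqnorm u).

Let sqnorm1_gt0 u : 0 < 1 + sqnorm u.
Proof. by rewrite ltr_wpDr ?sqnorm_ge0. Qed.

Lemma saturate_ge0 u : 0 <= saturate u.
Proof. by rewrite divr_ge0 ?sqnorm_ge0// ltW. Qed.

Lemma saturate_le1 u : saturate u <= 1.
Proof. by rewrite ler_pdivrMr// mul1r lerDr. Qed.

Lemma saturate0 : saturate 0 = 0.
Proof. by rewrite /saturate -sqr_enorm enorm0 expr0n mul0r. Qed.

Lemma saturate_far u i (r : R) : 0 < r -> r <= `|u ord0 i| ->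
  r ^+ 2 / (1 + r ^+ 2) <= saturate u.
Proof.
move=> r0 ri; have : r ^+ 2 <= sqnorm u.
  rewrite (le_trans _ (sqnorm_coord u i))// -[leRHS]real_normK ?num_real//.
  by rewrite lerXn2r ?nnegrE// ltW.
have := sqr_ge0 r; move: (r ^+ 2) => s s0 su.
rewrite /saturate ler_pdivrMr ?ltr_wpDr// mulrAC ler_pdivlMr//; nra.
Qed.

Lemma saturateD u e : saturate (u + e) - saturate u <=
  (2 * dotmul u e + sqnorm e) / (1 + sqnorm u) ^+ 2.
Proof.
have := sqnorm_ge0 (u + e); have := sqnorm_ge0 u.
rewrite /saturate sqnormD; move: (2 * _ + _) (sqnorm u) => r s s0 sr0.
have s1 : 0 < 1 + s by lra.
have sr1 : 0 < 1 + (s + r) by lra.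
have -> : (s + r) / (1 + (s + r)) - s / (1 + s) =
    r / (1 + s) ^+ 2 - r ^+ 2 / ((1 + s) ^+ 2 * (1 + (s + r))).
  by field; rewrite !gt_eqF.
by rewrite gerBl divr_ge0 ?sqr_ge0// mulr_ge0 ?sqr_ge0// ltW.
Qed.

Lemma saturate_lipschitz u v : saturate u - saturate v <= 2 * enorm (u - v).
Proof.
have [uv0|] := eqVneq (enorm (u - v)) 0; last first.
  move=> n0; have {n0}n0 : 0 < enorm (u - v) by rewrite lt0r n0 enorm_ge0.
  have [n1|n1] := leP 1 (enorm (u - v)).
    by have := saturate_le1 u; have := saturate_ge0 v; lra.
  have := saturateD v (u - v); rewrite [v + _]addrC subrK => /le_trans; apply.
  have := dotmul_le v (u - v) n0; rewrite -[sqnorm (u - v)]sqr_enorm.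
  have -> : enorm (u - v) ^+ 2 / enorm (u - v) = enorm (u - v).
    by rewrite expr2 mulfK// gt_eqF.
  rewrite ler_pdivrMr ?exprn_gt0//.
  have := sqnorm_ge0 v; move: n0 n1.
  move: (enorm _) (sqnorm v) (2 * _) => n s t n0 n1 s0 h; nra.
move/eqP: (uv0); rewrite sqrtr_eq0 => uv.
have z i : u ord0 i = v ord0 i.
  apply/eqP; rewrite -subr_eq0 -sqrf_eq0 eq_le sqr_ge0 andbT.
  have := sqnorm_coord (u - v) i; rewrite !mxE => /le_trans; exact.
rewrite uv0 mulr0 subr_le0 (_ : u = v)//.
by apply/rowP.
Qed.

(** A displacement of size [O(t (1 + |u|))] costs [O(t)] only, uniformly in [u]:
    the linear growth is compensated by the saturation. *)
Lemma saturate_drift (C x0 : R) : 0 <= C -> 0 <= x0 ->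
  exists2 K : R, 0 <= K & forall (t : R) u e, 0 < t -> t <= 1 ->
    enorm e <= t * (C * (1 + x0 + enorm u)) ->
    saturate (u + e) <= saturate u + K * t.
Proof.
move=> C0 x00.
(* Chosen so that [|e|^2 <= t^2 B (1 + |u|^2)]. *)
pose B := 2 * C ^+ 2 * (1 + x0) ^+ 2 + 2 * C ^+ 2.
have B0 : 0 <= B by rewrite /B; have := sqr_ge0 C; have := sqr_ge0 (1 + x0); nra.
exists (1 + 2 * B); first by lra.
move=> t u e t0 t1 et; rewrite -lerBlDl (le_trans (saturateD u e))//.
have se : sqnorm e <= t ^+ 2 * (B * (1 + sqnorm u)).
  rewrite -!sqr_enorm.
  apply: (@le_trans _ _ ((t * (C * (1 + x0 + enorm u))) ^+ 2)).
    by rewrite lerXn2r ?nnegrE ?enorm_ge0// !mulr_ge0 ?addr_ge0 ?enorm_ge0// ltW.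
  rewrite exprMn ler_wpM2l ?sqr_ge0// exprMn /B.
  have := enorm_ge0 u; move: (enorm u) => n n0.
  have a2 : (1 + x0 + n) ^+ 2 <= (2 * (1 + x0) ^+ 2 + 2) * (1 + n ^+ 2).
    have := sqr_ge0 (1 + x0 - n); have := sqr_ge0 (1 + x0).
    by have := sqr_ge0 n; nra.
  have -> : (2 * C ^+ 2 * (1 + x0) ^+ 2 + 2 * C ^+ 2) * (1 + n ^+ 2) =
    C ^+ 2 * ((2 * (1 + x0) ^+ 2 + 2) * (1 + n ^+ 2)) by ring.
  by rewrite ler_wpM2l// sqr_ge0.
have de := dotmul_le u e t0.
have su := sqnorm_ge0 u.
rewrite ler_pdivrMr ?exprn_gt0//.
have st : sqnorm e / t <= t * (B * (1 + sqnorm u)).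
  by rewrite ler_pdivrMr// mulrAC -expr2.
have se' : sqnorm e <= t * (B * (1 + sqnorm u)).
  rewrite (le_trans se)// ler_wpM2r//; first by rewrite mulr_ge0// addr_ge0.
  by rewrite expr2 ger_pMl.
apply: (@le_trans _ _ (t * ((1 + 2 * B) * (1 + sqnorm u)))).
  by move: (sqnorm u) su de st se' => s su de st se'; nra.
have -> : (1 + 2 * B) * t * (1 + sqnorm u) ^+ 2 =
  t * ((1 + 2 * B) * (1 + sqnorm u)) * (1 + sqnorm u) by ring.
by rewrite ler_peMr ?lerDl// !mulr_ge0 ?addr_ge0// ?mulr_ge0// ltW.
Qed.

(** The increments of [saturate] are dominated by the test functions whose
    expectations are [O(t)], with coefficients bounded uniformly in [u]. *)
Lemma saturate_increment u : exists2 a : 'I_d -> R, (forall i, `|a i| <= 1) &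
  forall z, saturate (u + z) - saturate u <=
    \sum_i a i * cutcoord i z + (1 + 5 / 2 * d%:R) * (1 - cutoff z).
Proof.
have s0 := sqnorm_ge0 u; have s1 := sqnorm1_gt0 u.
have s2 : 0 < (1 + sqnorm u) ^+ 2 by rewrite exprn_gt0.
have s3 : 1 <= (1 + sqnorm u) ^+ 2 by rewrite exprn_ege1// lerDl.
pose a i := 2 * u ord0 i / (1 + sqnorm u) ^+ 2.
have a1 i : `|a i| <= 1.
  rewrite normrM normfV (gtr0_norm s2) ler_pdivrMr// mul1r.
  rewrite (@le_trans _ _ (1 + sqnorm u))//; last by rewrite expr2 ler_peMl ?lerDl// ltW.
  have := sqnorm_coord u i; rewrite -[X in X <= _ -> _]real_normK ?num_real//.
  rewrite normrM normr_nat; have := sqr_ge0 (`|u ord0 i| - 1); nra.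
exists a => // z.
have k1 := cutoff_le1 z.
have d0 : 0 <= d%:R :> R by [].
have dE : d%:R = \sum_(i < d) 1 :> R by rewrite sumr_const card_ord.
have [[i zi]|/forallNP zi] := pselect (exists i, 1 <= `|z ord0 i|).
  rewrite big1 => [|j _]; last by rewrite cutcoordE (cutoff_out zi) !mulr0.
  rewrite add0r (cutoff_out zi) subr0 mulr1.
  by have := saturate_le1 (u + z); have := saturate_ge0 u; lra.
have {}zi i : `|z ord0 i| <= 1 by apply/ltW; rewrite ltNge; exact/negP/zi.
rewrite (le_trans (saturateD u z))// mulrDl.
have -> : 2 * dotmul u z / (1 + sqnorm u) ^+ 2 = \sum_i a i * z ord0 i.
  by rewrite /dotmul mulr_sumr mulr_suml; apply: eq_bigr => i _; rewrite /a; ring.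
have h1 : \sum_i a i * z ord0 i <= \sum_i a i * cutcoord i z + d%:R * (1 - cutoff z).
  rewrite dE mulr_suml -big_split/=.
  apply: ler_sum => i _; rewrite cutcoordE mul1r -lerBlDl.
  have -> : a i * z ord0 i - a i * (z ord0 i * cutoff z) =
    a i * z ord0 i * (1 - cutoff z) by ring.
  rewrite ler_piMl ?subr_ge0// (le_trans (ler_norm _))// normrM.
  by rewrite mulr_ile1.
have h2 : sqnorm z / (1 + sqnorm u) ^+ 2 <= 3 / 2 * d%:R * (1 - cutoff z).
  rewrite (@le_trans _ _ (sqnorm z))//.
    by rewrite ler_piMr ?sqnorm_ge0// invf_le1.
  rewrite dE mulr_sumr mulr_suml.
  apply: ler_sum => i _; have := cutoff_le (zi i); lra.
have : 0 <= 1 - cutoff z by lra.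
nra.
Qed.

Lemma enorm_lipschitz_continuous (f : E -> R) (L : R) :
  (forall x y, f x - f y <= L * enorm (x - y)) -> continuous f.
Proof.
move=> fL x; apply: (@cvgrPdist_le _ _ _ (nbhs x) (nbhs_filter x) _ _).2 => e e0.
have L1 : 0 < `|L| * (d%:R + 1) + 1.
  by rewrite ltr_wpDl// mulr_ge0// addr_ge0.
near=> y.
have h : `|x - y| <= e / (`|L| * (d%:R + 1) + 1).
  near: y; apply: (@cvgr_dist_le _ _ _ (nbhs x) (nbhs_filter x) id x (@cvg_id _ _)).
  by rewrite divr_gt0.
have Le (a b : E) : enorm (a - b) <= (d%:R + 1) * `|x - y| -> f a - f b <= e.
  move=> ab; rewrite (le_trans (fL _ _))// (le_trans (ler_wpM2r (enorm_ge0 _) (ler_norm L)))//.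
  rewrite (le_trans (ler_wpM2l (normr_ge0 L) ab))// mulrA.
  move: h; rewrite ler_pdivlMr// mulrDr mulr1 mulrC; apply: le_trans.
  by rewrite lerDl.
rewrite ler_norml lerNl opprB; apply/andP; split; apply: Le.
  by rewrite -opprB enormN enorm_le_norm.
exact: enorm_le_norm.
Unshelve. all: by end_near. Qed.

End SaturatedNorm.

(** * Expectations of bounded functions and optimal transport *)

Section BoundedExpectation.
Context {d : measure_display} {T : measurableType d} {R : realType}.
Variable P : probability T R.
Implicit Types f g : T -> R.

Lemma integrable_bounded f (M : R) : measurable_fun [set: T] f ->
  (forall x, `|f x| <= M) -> P.-integrable [set: T] (EFin \o f).
Proof.
move=> mf fM; apply: measurable_bounded_integrable => //.
  exact: (le_lt_trans (probability_le1 P measurableT) (ltry 1)).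
exists M; split; first exact: num_real.
by move=> N MN x _; exact: le_trans (fM x) (ltW MN).
Qed.

Lemma Rintegral_prob_cst (c : R) : \int[P]_x c = c.
Proof.
have -> : \int[P]_x c = c * fine (P [set: T]) by exact: Rintegral_cst.
by rewrite probability_setT mulr1.
Qed.

Lemma integrable_prob_cst (c : R) : P.-integrable [set: T] (EFin \o (fun=> c)).
Proof. by apply: (@integrable_bounded _ `|c|). Qed.

Lemma Rintegral_prob_le f (M : R) : P.-integrable [set: T] (EFin \o f) ->
  (forall x, f x <= M) -> \int[P]_x f x <= M.
Proof.
move=> fi fM; rewrite -[leRHS]Rintegral_prob_cst.
by apply: le_Rintegral => //; exact: integrable_prob_cst.
Qed.

Lemma Rintegral_prob_ge f (M : R) : P.-integrable [set: T] (EFin \o f) ->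
  (forall x, M <= f x) -> M <= \int[P]_x f x.
Proof.
move=> fi fM; rewrite -[leLHS]Rintegral_prob_cst.
by apply: le_Rintegral => //; exact: integrable_prob_cst.
Qed.

End BoundedExpectation.

Section Transport.
Context {R : realType} {d : nat}.
Local Notation E := 'rV[R]_d.
Local Notation B := (borelRd R d).

Lemma continuous_measurable_borelRd (f : E -> R) : continuous f ->
  measurable_fun [set: B] (f : B -> R).
Proof.
move=> /continuousP cf; apply: (measurability _ (RGenOpens.measurableE R)).
move=> _ [_ [a [b ->] <-]]; rewrite setTI.
by apply: sub_sigma_algebra; exact/cf/interval_open.
Qed.

Lemma measurable_enorm_diff : measurable_fun [set: B * B]
  (fun z : B * B => enorm ((z.1 : E) - (z.2 : E))).
Proof.
apply: (@measurableT_comp _ _ _ _ _ _ (@Num.sqrt R)).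
  by apply: continuous_measurable_fun; exact: sqrt_continuous.
apply: measurable_sum => i; apply: measurable_funX.
rewrite (_ : (fun z => _) = fun z : B * B => (z.1 : E) ord0 i - (z.2 : E) ord0 i); last first.
  by apply/funext => z; rewrite !mxE.
have mc : measurable_fun [set: B] (fun x : B => (x : E) ord0 i).
  by apply: continuous_measurable_borelRd; exact: coord_continuous.
apply: measurable_funB.
  by apply: (measurableT_comp mc); exact: measurable_fst.
by apply: (measurableT_comp mc); exact: measurable_snd.
Qed.

Lemma measurable_cost (p : R) : measurable_fun [set: B * B]
  (fun z : B * B => enorm ((z.1 : E) - (z.2 : E)) `^ p).
Proof.
apply: (@measurableT_comp _ _ _ _ _ _ (fun x : R => x `^ p)).
  exact: measurable_powR.
exact: measurable_enorm_diff.
Qed.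

Lemma coupling_fst (mu nu : probability B R) (g : probability (B * B)%type R)
    (f : E -> R) (M : R) : coupling mu nu g -> continuous f ->
  (forall x, `|f x| <= M) -> \int[g]_z f z.1 = \int[mu]_x f x.
Proof.
move=> gc cf fM; have mf := continuous_measurable_borelRd cf.
congr fine; rewrite -(@eq_measure_integral _ _ _ _ _ (pushforward g fst)).
  rewrite (@integral_pushforward _ _ (B * B)%type B) => //.

  - exact/measurable_EFinP.
  - apply: (@integrable_bounded _ _ _ g (fun z => f z.1) M) => //.
    by apply: measurableT_comp.
move=> A mA _; rewrite /pushforward; transitivity (g (A `*` setT)); last by have [] := gc _ mA.
by congr (g _); apply/seteqP; split => z //= [].
Qed.

Lemma coupling_snd (mu nu : probability B R) (g : probability (B * B)%type R)
    (f : E -> R) (M : R) : coupling mu nu g -> continuous f ->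
  (forall x, `|f x| <= M) -> \int[g]_z f z.2 = \int[nu]_x f x.
Proof.
move=> gc cf fM; have mf := continuous_measurable_borelRd cf.
congr fine; rewrite -(@eq_measure_integral _ _ _ _ _ (pushforward g snd)).
  rewrite (@integral_pushforward _ _ (B * B)%type B) => //.

  - exact/measurable_EFinP.
  - apply: (@integrable_bounded _ _ _ g (fun z => f z.2) M) => //.
    by apply: measurableT_comp.
move=> A mA _; rewrite /pushforward; transitivity (g (setT `*` A)); last by have [] := gc _ mA.
by congr (g _); apply/seteqP; split => z //= [].
Qed.

Let diagonal : B -> B * B := fun x => (x, x).
Let measurable_diagonal : measurable_fun [set: B] diagonal.
Proof. by apply: measurable_fun_pair. Qed.
HB.instance Definition _ := isMeasurableFun.Build _ _ _ _ diagonal measurable_diagonal.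

Lemma wasserstein_refl (p : R) (mu : probability B R) : 0 < p ->
  (wasserstein p mu mu <= 0)%E.
Proof.
move=> p0; pose g : probability (B * B)%type R := distribution mu diagonal.
rewrite /wasserstein.
suff -> : ereal_inf [set (\int[gamma]_z (enorm ((z.1 : E) - (z.2 : E)) `^ p)%:E)%E
              | gamma in coupling mu mu] = 0%E.
  by rewrite poweR_EFin powR0// invr_eq0 gt_eqF.
apply/eqP; rewrite eq_le; apply/andP; split; last first.
  apply/ereal_infP => _ [gamma _ <-]; apply: integral_ge0 => z _.
  by rewrite lee_fin powR_ge0.
apply: ereal_inf_lbound; exists g.
  move=> A mA; split; rewrite /g /= /distribution /pushforward; congr (mu _);
    by apply/seteqP; split => z //= [].
rewrite /g /= /distribution ge0_integral_pushforward//.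
- apply: integral0_eq => x _ /=; rewrite (subrr (x : E)) enorm0 powR0//.
  by rewrite gt_eqF.
- apply/measurable_EFinP; exact: measurable_cost.
- by move=> z _; rewrite lee_fin powR_ge0.
Qed.

(** For [r > 0] the elementary inequality [c <= r + r (c / r)^p] replaces
    Hoelder's inequality in the comparison of first and [p]-th order costs. *)
Lemma wasserstein_lipschitz (p : R) (mu nu : probability B R) (r : R)
    (f : E -> R) (L M : R) : 1 < p -> 0 < r -> 0 <= L -> continuous f ->
  (forall x, `|f x| <= M) -> (forall x y, f x - f y <= L * enorm (x - y)) ->
  (wasserstein p mu nu < r%:E)%E ->
  \int[nu]_x f x <= \int[mu]_x f x + 2 * L * r.
Proof.
move=> p1 r0 L0 cf fM fL wr; have p0 : 0 < p by rewrite (lt_trans ltr01).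
set I := ereal_inf [set (\int[gamma]_z (enorm ((z.1 : E) - (z.2 : E)) `^ p)%:E)%E
              | gamma in coupling mu nu] in wr.
have I0 : (0 <= I)%E.
  apply/ereal_infP => _ [gamma _ <-]; apply: integral_ge0 => z _.
  by rewrite lee_fin powR_ge0.
have rp0 : 0 < r `^ p by rewrite powR_gt0.
have Ir : (I < (r `^ p)%:E)%E.
  rewrite ltNge; apply: contraTN wr => Ir; rewrite -leNgt.
  have -> : r%:E = (((r `^ p)%:E) `^ p^-1)%E.
    by rewrite poweR_EFin -powRrM mulfV ?gt_eqF// powRr1// ltW.
  apply: gt0_ler_poweR => //.
  - by rewrite invr_ge0 ltW.
  - by rewrite in_itv/= leey andbT lee_fin ltW.
  - by rewrite in_itv/= leey andbT.
have [_ [g gc <-] gr] := ereal_inf_lt Ir.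
rewrite -(coupling_fst gc cf fM) -(coupling_snd gc cf fM).
pose c (z : B * B) : R := enorm ((z.1 : E) - (z.2 : E)) `^ p.
have c0 z : 0 <= c z by rewrite powR_ge0.
have ci : g.-integrable [set: B * B] (EFin \o c).
  apply/integrableP; split; first by apply/measurable_EFinP; exact: measurable_cost.
  rewrite (eq_integral (EFin \o c)); last by move=> z _; rewrite /= ger0_norm.
  by rewrite (lt_trans gr)// ltry.
have mf := continuous_measurable_borelRd cf.
have fi1 : g.-integrable [set: B * B] (EFin \o (fun z : B * B => f z.1)).
  by apply: (@integrable_bounded _ _ _ _ _ M) => //; apply: measurableT_comp.
have fi2 : g.-integrable [set: B * B] (EFin \o (fun z : B * B => f z.2)).
  by apply: (@integrable_bounded _ _ _ _ _ M) => //; apply: measurableT_comp.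
pose K := L * r / r `^ p.
have K0 : 0 <= K by rewrite divr_ge0 ?mulr_ge0// ltW.
have Kci : g.-integrable [set: B * B] (EFin \o (fun z => K * c z)).
  exact: (integrableZl measurableT K ci).
have Ki : g.-integrable [set: B * B] (EFin \o (fun z => L * r + K * c z)).
  exact: (integrableD measurableT (integrable_prob_cst g (L * r)) Kci).
apply: (@le_trans _ _ (\int[g]_z (f z.1 + (L * r + K * c z)))).
  apply: le_Rintegral => //; first exact: (integrableD measurableT fi1 Ki).
  move=> z _; rewrite -lerBlDl.
  have := fL z.2 z.1; rewrite -enormN opprB => /le_trans; apply.
  have cost : enorm (z.1 - z.2) <= r + r * (c z / r `^ p).
    have [er|er] := leP (enorm (z.1 - z.2)) r.
      by rewrite (le_trans er)// lerDl mulr_ge0 ?divr_ge0// ltW.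
    rewrite (@le_trans _ _ (r * (c z / r `^ p)))//; last by rewrite lerDr ltW.
    rewrite mulrC -ler_pdivrMr//.
    have -> : c z / r `^ p = (enorm (z.1 - z.2) / r) `^ p.
      apply: (mulIf (lt0r_neq0 rp0)); rewrite mulfVK ?gt_eqF//.
      by rewrite -powRM ?divr_ge0 ?enorm_ge0 ?ltW// mulfVK ?gt_eqF.
    rewrite -[leLHS]powRr1; last by rewrite divr_ge0 ?enorm_ge0// ltW.
    by apply: ler_powR; [rewrite ler_pdivlMr// mul1r ltW|exact: ltW].
  have -> : L * r + K * c z = L * (r + r * (c z / r `^ p)) by rewrite /K; ring.
  by rewrite ler_wpM2l.
rewrite RintegralD// RintegralD//; last exact: integrable_prob_cst.
rewrite Rintegral_prob_cst lerD2l RintegralZl//.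
have cr : \int[g]_z c z <= r `^ p.
  rewrite -lee_fin /Rintegral fineK; first exact: ltW.
  rewrite ge0_fin_numE; first by rewrite (lt_trans gr)// ltry.
  by apply: integral_ge0 => z _; rewrite lee_fin.
have : K * \int[g]_z c z <= L * r.
  rewrite (le_trans (ler_wpM2l K0 cr))// /K mulfVK// gt_eqF//.
lra.
Qed.

End Transport.

(** * One step of the scheme *)

Section OneStep.
Context {R : realType} {d : nat}.
Local Notation E := 'rV[R]_d.
Local Notation B := (borelRd R d).

Lemma integrable_borelRd (P : probability B R) (f : E -> R) (M : R) :
  continuous f -> (forall x, `|f x| <= M) ->
  P.-integrable [set: B] (EFin \o (f : B -> R)).
Proof.
move=> cf fM; apply: (@integrable_bounded _ _ _ _ _ M) => //.
exact: continuous_measurable_borelRd.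
Qed.

(** A crude form of the triangle inequality, directly from Young's. *)
Lemma enormD_le (u v : E) : enorm (u + v) <= 2 * (enorm u + enorm v).
Proof.
have n0 : 0 <= 2 * (enorm u + enorm v) by rewrite mulr_ge0// addr_ge0 ?enorm_ge0.
rewrite -(ger0_norm n0) -[leRHS]sqrtr_sqr ler_wsqrtr// -/(sqnorm _) sqnormD.
have := @dotmul_le _ _ u v 1 ltr01; rewrite -!sqr_enorm.
have := enorm_ge0 u; have := enorm_ge0 v.
move: (enorm u) (enorm v) => a b a0 b0 h; nra.
Qed.

Lemma Rintegral_lin_comb_le (P : probability B R) (r : seq 'I_d)
    (a : 'I_d -> R) (f : 'I_d -> E -> R) (c M : R) :
  (forall i, `|a i| <= 1) -> (forall i, continuous (f i)) ->
  (forall i x, `|f i x| <= M) -> (forall i, `|\int[P]_x f i x| <= c) ->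
  P.-integrable [set: B] (EFin \o (fun x => \sum_(i <- r) a i * f i x)) /\
  \int[P]_x (\sum_(i <- r) a i * f i x) <= (size r)%:R * c.
Proof.
move=> a1 cf fM fc; elim: r => [|i r [IHi IHr]].
  rewrite [X in \int[P]_x X x](_ : _ = fun=> 0); last first.
    by apply/funext => x; rewrite big_nil.
  rewrite [X in EFin \o X](_ : _ = fun=> 0); last first.
    by apply/funext => x; rewrite big_nil.
  by rewrite Rintegral_prob_cst mul0r; split => //; exact: integrable_prob_cst.
have fi := integrable_borelRd P (cf i) (fM i).
have afi := integrableZl measurableT (a i) fi.
rewrite [X in \int[P]_x X x](_ : _ = fun x => a i * f i x + \sum_(j <- r) a j * f j x); last first.
  by apply/funext => x; rewrite big_cons.
rewrite [X in EFin \o X](_ : _ = fun x => a i * f i x + \sum_(j <- r) a j * f j x); last first.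
  by apply/funext => x; rewrite big_cons.
split; first exact: (integrableD measurableT afi IHi).
rewrite RintegralD// RintegralZl//= -natr1 mulrDl mul1r addrC lerD//.
rewrite (le_trans (ler_norm _))// normrM.
by rewrite (le_trans _ (fc i))// ler_piMl.
Qed.

Context {A : Type}.
Variables (p m : R) (mu : A -> R -> probability B R) (psi : A -> R -> E -> E).

Hypothesis test_function_growth : forall chi : E -> R, Cc_infty chi ->
  (limf_esup
     (fun t : R => ereal_sup
        [set (`| \int[mu a t]_y ((chi (y : E) - chi 0) / t) |)%:E
        | a in [set: A]])
     (0 : R)^'+ < +oo)%E.

Lemma test_function_growth_near (chi : E -> R) (M : R) : Cc_infty chi ->
  continuous chi -> (forall x, `|chi x| <= M) ->
  exists2 C : R, 0 <= C & \forall t \near 0^'+, forall a : A,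
    `|\int[mu a t]_y chi y - chi 0| <= C * t.
Proof.
move=> chiC chic chiM.
have /ereal_inf_lt[_ [V V0 <-]] := test_function_growth chiC.
set s := ereal_sup _ => sy; exists `|fine s| => //.
near=> t => a.
have t0 : 0 < t by near: t; exact: nbhs_right_gt.
have Vt : V t by near: t.
have chii := integrable_borelRd (mu a t) chic chiM.
have chi0i := integrable_prob_cst (mu a t) (chi 0).
have : (`| \int[mu a t]_y ((chi (y : E) - chi 0) / t) |%:E <= s)%E.
  apply: le_ereal_sup_tmp; eexists; first by exists t => //; reflexivity.
  by apply: ereal_sup_ubound; exists a.
rewrite RintegralZr//; last exact: (integrableB measurableT chii chi0i).
rewrite RintegralB// Rintegral_prob_cst normrM normfV (gtr0_norm t0).
case: s sy => [s| |] // _; rewrite lee_fin /= => h.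
by rewrite -ler_pdivrMr// (le_trans h)// ler_norm.
Unshelve. all: by end_near. Qed.

(** First-order growth of the truncated first and second moments. *)
Lemma truncated_moments_near :
  exists2 C : R, 0 <= C & \forall t \near 0^'+, forall a : A,
    \int[mu a t]_y (1 - cutoff y) <= C * t /\
    forall i : 'I_d, `|\int[mu a t]_y cutcoord i y| <= C * t.
Proof.
have k1 (x : E) : `|cutoff x| <= 1 :> R by rewrite ger0_norm ?cutoff_ge0 ?cutoff_le1.
have [C0 C00 nC0] := test_function_growth_near Cc_infty_cutoff
  continuous_cutoff k1.
have /choice[C nC] : forall i : 'I_d, exists C : R, 0 <= C /\
    \forall t \near 0^'+, forall a : A, `|\int[mu a t]_y cutcoord i y| <= C * t.
  move=> i; have [C C_ge0 nC] := test_function_growth_near (Cc_infty_cutcoord i)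
    (@continuous_cutcoord _ _ i) (@cutcoord_le1 _ _ i).
  exists C; split => //; move: nC.
  by rewrite cutcoordE mxE mul0r; under eq_near do under eq_forall do rewrite subr0.
have sC : 0 <= \sum_i C i by apply: sumr_ge0 => i _; exact: (nC i).1.
exists (C0 + \sum_i C i); first by rewrite addr_ge0.
have nC' : \forall t \near 0^'+, forall i a, `|\int[mu a t]_y cutcoord i y| <= C i * t.
  by apply: filter_forall => i; exact: (nC i).2.
near=> t => a.
have t0 : 0 < t by near: t; exact: nbhs_right_gt.
split.
  rewrite RintegralB//; last first.
  - exact: integrable_borelRd continuous_cutoff k1.
  - exact: integrable_prob_cst.
  rewrite Rintegral_prob_cst -(@cutoff0 R d).
  apply: (@le_trans _ _ (C0 * t)); last by rewrite ler_wpM2r ?(ltW t0)// lerDl.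
  rewrite (le_trans (ler_norm _))// distrC.
  by move: a; near: t.
move=> i; apply: (@le_trans _ _ (C i * t)).
  by move: i a; near: t.
rewrite ler_wpM2r ?(ltW t0)// (bigD1 i)//= addrCA lerDl addr_ge0// sumr_ge0// => j _.
exact: (nC j).1.
Unshelve. all: by end_near. Qed.

Hypothesis p_gt1 : 1 < p.
Hypothesis m_ge0 : 0 <= m.
Hypothesis drift : exists2 C : R, 0 < C & forall a (t : R) x, 0 < t ->
  enorm (psi a t x - x) / t <= C * (1 + enorm x).

Lemma wball_lipschitz a (t : R) (nu : probability B R) (f : E -> R) (L M : R) :
  0 < t -> wball p m mu a t nu -> 0 <= L -> (forall x, `|f x| <= M) ->
  (forall x y, f x - f y <= L * enorm (x - y)) ->
  \int[nu]_x f x <= \int[mu a t]_x f x + 2 * L * (t * (m + 1)).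
Proof.
move=> t0 [_ nut] L0 fM fL.
(* [t * (m + 1)] strictly exceeds the radius [t * m], even for [m = 0]. *)
apply: (@wasserstein_lipschitz _ _ p _ _ _ _ _ M) => //.
- by rewrite mulr_gt0// ltr_wpDl.
- exact: enorm_lipschitz_continuous fL.
- by rewrite (le_lt_trans nut)// lte_fin ltr_pM2l// ltrDl.
Qed.

(** The saturated squared distance to [x0] is a Lyapunov function of the scheme:
    one step of length [t] raises its worst expectation by [O(t)], uniformly in
    the starting point, the control and the measure in the Wasserstein ball. *)
Lemma saturate_one_step (x0 : E) : exists2 K : R, 0 <= K & exists2 t0 : R, 0 < t0 &
  forall (t : R) a y nu, 0 < t -> t <= t0 -> wball p m mu a t nu ->
    \int[nu]_z saturate (psi a t y + (z : E) - x0) <= saturate (y - x0) + K * t.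
Proof.
have [C0 C00 nC0] := truncated_moments_near.
have [C C_gt0 psiC] := drift.
have C2 : 0 <= 2 * C by rewrite mulr_ge0// ltW.
have [K1 K10 satK1] := @saturate_drift R d (2 * C) (enorm x0) C2 (enorm_ge0 x0).
have [t0 t00 ht0] : exists2 t0 : R, 0 < t0 & forall t, 0 < t -> t <= t0 -> t <= 1 /\ forall a : A,
    \int[mu a t]_y (1 - cutoff y) <= C0 * t /\
    forall i : 'I_d, `|\int[mu a t]_y cutcoord i y| <= C0 * t.
  have [e /= e0 he] := nC0.
  exists (Num.min 1 (e / 2)); first by rewrite lt_min ltr01 divr_gt0.
  move=> t tgt0; rewrite le_min => /andP[t1 te]; split => //.
  by apply: he => //=; rewrite sub0r normrN gtr0_norm//; lra.
pose D : R := 1 + 5 / 2 * d%:R.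
have D0 : 0 <= D by rewrite addr_ge0// mulr_ge0.
exists (K1 + d%:R * C0 + D * C0 + 4 * (m + 1)).
  by rewrite !addr_ge0// ?mulr_ge0// addr_ge0.
exists t0 => // t a y nu tgt0 tt0 nut.
have [t1 /(_ a)[h1 h2]] := ht0 _ tgt0 tt0.
pose u : E := psi a t y - x0.
have sat1 (x : E) : `|saturate x| <= 1 :> R by rewrite ger0_norm ?saturate_ge0 ?saturate_le1.
have satu1 (z : E) : `|saturate (u + z)| <= 1 by exact: sat1.
have satuL (x z : E) : saturate (u + x) - saturate (u + z) <= 2 * enorm (x - z).
  by rewrite (le_trans (saturate_lipschitz _ _))// opprD addrACA subrr add0r.
rewrite (_ : (fun z : B => _) = fun z : B => saturate (u + (z : E))); last first.
  by apply/funext => z; rewrite /u addrAC.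
have [b b1 hb] := saturate_increment u.
have csatu : continuous (fun z : E => saturate (u + z)) := enorm_lipschitz_continuous satuL.
have step1 := wball_lipschitz tgt0 nut (ler0n R 2) satu1 satuL.
have k1 (x : E) : `|cutoff x| <= 1 :> R by rewrite ger0_norm ?cutoff_ge0 ?cutoff_le1.
have [sumi sum_le] := @Rintegral_lin_comb_le (mu a t) (index_enum _) b (@cutcoord _ _) _ 1
  b1 (@continuous_cutcoord _ _) (@cutcoord_le1 _ _) h2.
have ki : (mu a t).-integrable [set: B] (EFin \o (fun z : B => 1 - cutoff (z : E))).
  exact: (integrableB measurableT (integrable_prob_cst _ _)
    (integrable_borelRd _ continuous_cutoff k1)).
have Dki := integrableZl measurableT D ki.
have step2 : \int[mu a t]_z saturate (u + (z : E)) <= saturate u + (d%:R * (C0 * t) + D * (C0 * t)).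
  apply: (@le_trans _ _ (\int[mu a t]_z (saturate u +
      (\sum_i b i * cutcoord i (z : E) + D * (1 - cutoff (z : E)))))).
    apply: le_Rintegral => //.
    - exact: (integrable_borelRd _ csatu satu1).
    - exact: (integrableD measurableT (integrable_prob_cst _ _) (integrableD measurableT sumi Dki)).
    - by move=> z _; rewrite -lerBlDl; exact: hb.
  rewrite RintegralD//; last first.
  - exact: (integrableD measurableT sumi Dki).
  - exact: integrable_prob_cst.
  rewrite Rintegral_prob_cst lerD2l RintegralD// RintegralZl//.
  apply: lerD; last by rewrite ler_wpM2l.
  rewrite (le_trans sum_le)//.
  by rewrite -sum1_size sum1_card card_ord.
have step3 : saturate u <= saturate (y - x0) + K1 * t.
  rewrite (_ : u = (y - x0) + (psi a t y - y)); last first.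
    by rewrite /u [RHS]addrC addrA subrK.
  apply: satK1 => //; have := psiC a t y tgt0.
  rewrite ler_pdivrMr// mulrC => /le_trans; apply; rewrite ler_wpM2l ?(ltW tgt0)//.
  rewrite [2 * C]mulrC -mulrA ler_wpM2l ?(ltW C_gt0)//.
  have := enormD_le (y - x0) x0; rewrite subrK; lra.
move: step1 step2 step3; nra.
Qed.

End OneStep.

(** * Comparison for the iterated operators *)

Section Scheme.
Context {R : realType} {d : nat} {A : Type}.
Local Notation E := 'rV[R]_d.
Local Notation B := (borelRd R d).

(** The one-step operators preserve this class because the flow is Lipschitz;
    its members are measurable, so that all the integrals met along a chain of
    steps are additive and monotone. *)
Definition bounded_lipschitz (M : R) (f : E -> R) : Prop :=
  (forall x, `|f x| <= M) /\
  exists2 L : R, 0 <= L & forall x y, f x - f y <= L * enorm (x - y).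

Lemma bounded_lipschitz_cst (c : R) : bounded_lipschitz `|c| (fun=> c).
Proof. by split => //; exists 0 => // x y; rewrite subrr mul0r. Qed.

Lemma bounded_lipschitz_Cb M (f : E -> R) : bounded_lipschitz M f -> Cb f.
Proof.
move=> [fM [L L0 fL]]; split; first exact: enorm_lipschitz_continuous fL.
by exists M.
Qed.

Lemma integrable_bounded_lipschitz (P : probability B R) M (f : E -> R) (w : E) :
  bounded_lipschitz M f ->
  P.-integrable [set: B] (EFin \o (fun z : B => f (w + (z : E)))).
Proof.
move=> [fM [L L0 fL]].
apply: (@integrable_borelRd _ _ P (fun z : E => f (w + z)) M) => //.
apply: (@enorm_lipschitz_continuous _ _ _ L) => x y.
by rewrite (le_trans (fL _ _))// opprD addrACA subrr add0r.
Qed.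

Lemma Rintegral_shift_bound (P : probability B R) M (f : E -> R) (w : E) :
  bounded_lipschitz M f -> `|\int[P]_z f (w + (z : E))| <= M.
Proof.
move=> fb; have fi := integrable_bounded_lipschitz P w fb.
have [fM _] := fb; rewrite ler_norml; apply/andP; split.
- by apply: Rintegral_prob_ge => // z; have := fM (w + z); rewrite ler_norml => /andP[].
- by apply: Rintegral_prob_le => // z; have := fM (w + z); rewrite ler_norml => /andP[].
Qed.

Variables (p m : R) (mu : A -> R -> probability B R) (psi : A -> R -> E -> E).
Hypothesis p_gt1 : 1 < p.
Hypothesis m_ge0 : 0 <= m.
Variable a0 : A.
Hypothesis mu_moment : forall a (t : R), 0 <= t -> finite_moment p (mu a t).

(** Nonemptiness of the balls; the supremum of the empty set would be 0. *)
Lemma wball_center a (t : R) : 0 <= t -> wball p m mu a t (mu a t).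
Proof.
move=> t0; split; first exact: mu_moment.
by rewrite (le_trans (wasserstein_refl _ (lt_trans ltr01 p_gt1)))// lee_fin mulr_ge0.
Qed.

Lemma Iop_ge M (t : R) (f : E -> R) x : 0 <= t -> bounded_lipschitz M f ->
  - M <= Iop p m mu psi t f x.
Proof.
move=> t0 fb; apply: lb_le_inf; first by eexists; exists a0.
move=> _ [a _ <-].
apply: (@le_trans _ _ (\int[mu a t]_z f (psi a t x + (z : E)))).
  by have := Rintegral_shift_bound (mu a t) (psi a t x) fb; rewrite ler_norml => /andP[].
apply: ub_le_sup; last by exists (mu a t) => //; exact: wball_center.
exists M => _ [nu _ <-].
by rewrite (le_trans (ler_norm _))// (Rintegral_shift_bound _ _ fb).
Qed.

Lemma Iop_le M M' (t : R) (f g : E -> R) x y (c : R) : 0 <= t ->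
  bounded_lipschitz M f -> bounded_lipschitz M' g ->
  (forall a nu, wball p m mu a t nu ->
    \int[nu]_z f (psi a t x + (z : E)) <= \int[nu]_z g (psi a t y + (z : E)) + c) ->
  Iop p m mu psi t f x <= Iop p m mu psi t g y + c.
Proof.
move=> t0 fb gb fg; rewrite -lerBlDr; apply: lb_le_inf; first by eexists; exists a0.
move=> _ [a _ <-]; rewrite lerBlDr.
apply: (@le_trans _ _ (sup [set \int[nu]_z f (psi a t x + (z : E)) | nu in wball p m mu a t])).
  apply: ge_inf; last by exists a.
  exists (- M) => _ [b _ <-].
  apply: (@le_trans _ _ (\int[mu b t]_z f (psi b t x + (z : E)))).
    by have := Rintegral_shift_bound (mu b t) (psi b t x) fb; rewrite ler_norml => /andP[].
  apply: ub_le_sup; last by exists (mu b t) => //; exact: wball_center.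
  exists M => _ [nu _ <-].
  by rewrite (le_trans (ler_norm _))// (Rintegral_shift_bound _ _ fb).
apply: ge_sup.
  by eexists; exists (mu a t); [exact: wball_center|reflexivity].
move=> _ [nu nut <-]; rewrite (le_trans (fg _ _ nut))// lerD2r.
apply: ub_le_sup; last by exists nu.
exists M' => _ [nu' _ <-].
by rewrite (le_trans (ler_norm _))// (Rintegral_shift_bound _ _ gb).
Qed.

Lemma Iop_bound M (t : R) (f : E -> R) x : 0 <= t -> bounded_lipschitz M f ->
  `|Iop p m mu psi t f x| <= M.
Proof.
move=> t0 fb; rewrite ler_norml (Iop_ge _ t0 fb)/=.
have zb : bounded_lipschitz 0 (fun=> 0 : R).
  by have := bounded_lipschitz_cst 0; rewrite normr0.
have := @Iop_le M 0 t f (fun=> 0) x x M t0 fb zb; rewrite addrC.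
have -> : Iop p m mu psi t (fun=> 0) x = 0.
  rewrite /Iop; rewrite [X in inf X](_ : _ = [set 0]); first by rewrite inf1.
  apply/seteqP; split => [_ [a _ <-]|_ ->].
    rewrite [X in sup X](_ : _ = [set 0]) ?sup1//.
    apply/seteqP; split => [_ [nu _ <-]|_ ->] /=.
      by rewrite Rintegral_prob_cst.
    by exists (mu a t); [exact: wball_center|rewrite Rintegral_prob_cst].
  exists a0 => //; rewrite [X in sup X](_ : _ = [set 0]) ?sup1//.
  apply/seteqP; split => [_ [nu _ <-]|_ ->] /=.
    by rewrite Rintegral_prob_cst.
  by exists (mu a0 t); [exact: wball_center|rewrite Rintegral_prob_cst].
rewrite addr0; apply => a nu _; rewrite Rintegral_prob_cst add0r.
by rewrite (le_trans (ler_norm _))// (Rintegral_shift_bound _ _ fb).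
Qed.

Hypothesis psi_lipschitz : exists2 c : R, 0 <= c &
  forall a (t : R) x1 x2, 0 <= t ->
    enorm (psi a t x1 - psi a t x2) <= expR (c * t) * enorm (x1 - x2).

Lemma bounded_lipschitz_Iop M (t : R) (f : E -> R) : 0 <= t ->
  bounded_lipschitz M f -> bounded_lipschitz M (Iop p m mu psi t f).
Proof.
move=> t0 fb; split; first by move=> x; exact: Iop_bound.
have [c c0 psic] := psi_lipschitz; have [_ [L L0 fL]] := fb.
exists (L * expR (c * t)); first by rewrite mulr_ge0// expR_ge0.
move=> x y; rewrite lerBlDl; apply: (Iop_le t0 fb fb) => a nu _.
rewrite addrC -[X in _ <= X + _](Rintegral_prob_cst nu) -RintegralD//; last first.
- exact: integrable_bounded_lipschitz fb.
- exact: integrable_prob_cst.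
apply: le_Rintegral => //.
- exact: integrable_bounded_lipschitz fb.
- exact: (integrableD measurableT (integrable_prob_cst _ _) (integrable_bounded_lipschitz _ _ fb)).
move=> z _; rewrite -lerBlDr (le_trans (fL _ _))// opprD addrACA subrr addr0.
by rewrite -mulrA ler_wpM2l// psic.
Qed.

Variables (x0 : E) (K t0 : R).
Hypothesis K_ge0 : 0 <= K.
Hypothesis one_step : forall (t : R) a y nu, 0 < t -> t <= t0 -> wball p m mu a t nu ->
  \int[nu]_z saturate (psi a t y + (z : E) - x0) <= saturate (y - x0) + K * t.

Lemma saturate_bounded_lipschitz : bounded_lipschitz 1 (fun y : E => saturate (y - x0)).
Proof.
split; first by move=> y; rewrite ger0_norm ?saturate_ge0 ?saturate_le1.
exists 2 => // x y; rewrite (le_trans (saturate_lipschitz _ _))//.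
by rewrite opprB addrA subrK.
Qed.

(** The Lyapunov bound lets a comparison of two functions up to the penalty
    [b * saturate (y - x0)] propagate through one step. *)
Lemma Iop_comparison M M' (t : R) (f g : E -> R) (c b : R) : 0 < t -> t <= t0 ->
  0 <= b -> bounded_lipschitz M f -> bounded_lipschitz M' g ->
  (forall y, f y <= g y + (c + b * saturate (y - x0))) ->
  forall y, Iop p m mu psi t f y <=
    Iop p m mu psi t g y + ((c + b * (K * t)) + b * saturate (y - x0)).
Proof.
move=> tgt0 tt0 b0 fb gb fg y; apply: (Iop_le (ltW tgt0) fb gb) => a nu nut.
have fi := integrable_bounded_lipschitz nu (psi a t y) fb.
have gi := integrable_bounded_lipschitz nu (psi a t y) gb.
have si : nu.-integrable [set: B] (EFin \o (fun z : B => saturate (psi a t y + (z : E) - x0))).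
  exact: (integrable_bounded_lipschitz nu (psi a t y) saturate_bounded_lipschitz).
have bsi := integrableZl measurableT b si.
have ci := integrable_prob_cst nu c.
apply: (@le_trans _ _ (\int[nu]_z (g (psi a t y + (z : E)) +
    (c + b * saturate (psi a t y + (z : E) - x0))))).
  apply: le_Rintegral => //.
  exact: (integrableD measurableT gi (integrableD measurableT ci bsi)).
rewrite RintegralD//; last exact: (integrableD measurableT ci bsi).
rewrite lerD2l RintegralD// RintegralZl// Rintegral_prob_cst -addrA lerD2l -mulrDr.
by rewrite ler_wpM2l// [leRHS]addrC one_step.
Qed.

Lemma bounded_lipschitz_Ichain M s x (f : E -> R) : path <%R x s ->
  bounded_lipschitz M f -> bounded_lipschitz M (Ichain p m mu psi (x :: s) f).
Proof.
elim: s x => [//|y s IHs] x /= /andP[xy ys] fb.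
by apply: bounded_lipschitz_Iop; [rewrite subr_ge0 ltW|exact: IHs].
Qed.

Lemma path_lt_last (x : R) s : path <%R x s -> x <= last x s.
Proof.
elim: s x => [//|y s IHs] x /= /andP[xy ys].
by rewrite (le_trans (ltW xy))// IHs.
Qed.

Lemma Ichain_comparison M M' s x (f g : E -> R) (c b : R) : path <%R x s ->
  last x s - x <= t0 -> 0 <= b ->
  bounded_lipschitz M f -> bounded_lipschitz M' g ->
  (forall y, f y <= g y + (c + b * saturate (y - x0))) ->
  forall y, Ichain p m mu psi (x :: s) f y <= Ichain p m mu psi (x :: s) g y +
    ((c + b * (K * (last x s - x))) + b * saturate (y - x0)).
Proof.
elim: s x => [|x1 s IHs] x.
  by move=> _ _ b0 _ _ fg y /=; rewrite subrr !mulr0 addr0.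
move=> /= /andP[xx1 x1s] lt0 b0 fb gb fg y.
have x1l := path_lt_last x1s.
rewrite (_ : c + b * (K * (last x1 s - x)) =
    (c + b * (K * (last x1 s - x1))) + b * (K * (x1 - x))); last by ring.
apply: Iop_comparison => //.
- by rewrite subr_gt0.
- by rewrite (le_trans _ lt0)// lerD2r.
- exact: bounded_lipschitz_Ichain fb.
- exact: bounded_lipschitz_Ichain gb.
- by apply: IHs => //; rewrite (le_trans _ lt0)// lerD2l lerN2 ltW.
Qed.

Lemma sort_partition_upto (t : R) (pi : {fset R}) : partition_upto t pi ->
  exists x s, [/\ sort <=%R (enum_fset pi) = x :: s, path <%R x s & last x s - x <= t].
Proof.
move=> [pi0 pit pib]; case es : (sort <=%R (enum_fset pi)) => [|x s].
  have : 0 \in sort <=%R (enum_fset pi) by rewrite mem_sort; exact: pi0.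
  by rewrite es.
exists x, s; split => //.
  have : sorted <%R (sort <=%R (enum_fset pi)) by rewrite sort_lt_sorted fset_uniq.
  by rewrite es.
have inpi z : z \in x :: s -> 0 <= z <= t.
  by rewrite -es mem_sort => zpi; apply: pib.
have /andP[x_ge0 _] := inpi x (mem_head _ _).
have /andP[_ lt] := inpi _ (mem_last x s).
by rewrite lerBlDr (le_trans lt)// lerDl.
Qed.

Lemma partition_upto_neq0 (t : R) : 0 <= t -> partition_upto t !=set0.
Proof.
move=> t_ge0; exists [fset 0; t]%fset; split; rewrite ?inE ?eqxx ?orbT//.
by move=> s; rewrite !inE => /orP[|] /eqP ->; rewrite ?lexx ?t_ge0.
Qed.

Lemma Ipart_bound M t pi (f : E -> R) y : partition_upto t pi ->
  bounded_lipschitz M f -> `|Ipart p m mu psi pi f y| <= M.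
Proof.
move=> /sort_partition_upto[x [s [es xs _]]] fb; rewrite /Ipart es.
exact: (bounded_lipschitz_Ichain xs fb).1.
Qed.

Lemma Sop_bound M t (f : E -> R) y : 0 <= t -> bounded_lipschitz M f ->
  `|Sop p m mu psi t f y| <= M.
Proof.
move=> t_ge0 fb; have [pi pit] := partition_upto_neq0 t_ge0.
rewrite ler_norml; apply/andP; split.
  apply: lb_le_inf; first by eexists; exists pi.
  move=> _ [pi' pit' <-]; have := Ipart_bound y pit' fb.
  by rewrite ler_norml => /andP[].
apply: (@le_trans _ _ (Ipart p m mu psi pi f y)).
  apply: ge_inf; last by exists pi.
  exists (- M) => _ [pi' pit' <-]; have := Ipart_bound y pit' fb.
  by rewrite ler_norml => /andP[].
by rewrite (le_trans (ler_norm _))// (Ipart_bound y pit fb).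
Qed.

(** Evaluated at [x0], where the penalty vanishes, the comparison along a
    partition only retains the accumulated increments [b * K * t]. *)
Lemma Sop_comparison M M' (t : R) (f g : E -> R) (c b : R) : 0 <= t -> t <= t0 ->
  0 <= b -> bounded_lipschitz M f -> bounded_lipschitz M' g ->
  (forall y, f y <= g y + (c + b * saturate (y - x0))) ->
  Sop p m mu psi t f x0 <= Sop p m mu psi t g x0 + (c + b * (K * t)).
Proof.
move=> t_ge0 tt0 b0 fb gb fg; have [pi pit] := partition_upto_neq0 t_ge0.
rewrite -lerBlDr; apply: lb_le_inf; first by eexists; exists pi.
move=> _ [{pit}pi pit <-]; rewrite lerBlDr.
apply: (@le_trans _ _ (Ipart p m mu psi pi f x0)).
  apply: ge_inf; last by exists pi.
  exists (- M) => _ [pi' pit' <-]; have := Ipart_bound x0 pit' fb.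
  by rewrite ler_norml => /andP[].
have [x [s [es xs ls]]] := sort_partition_upto pit.
rewrite /Ipart es.
have := Ichain_comparison xs (le_trans ls tt0) b0 fb gb fg x0.
rewrite subrr saturate0 mulr0 addr0 => /le_trans; apply.
by rewrite lerD2l lerD2l ler_wpM2l// ler_wpM2l.
Qed.

End Scheme.

(** * Time expansion of the test functions *)

Section TestFunctions.
Context {R : realType} {d : nat}.
Local Notation E := 'rV[R]_d.

Lemma is_derive_line {V : normedModType R} (phi : V -> R) (z v : V) (r : R) :
  differentiable phi (z + r *: v) ->
  is_derive r (1 : R) (fun s : R => phi (z + s *: v)) ('d phi (z + r *: v) v).
Proof.
move=> dphi; rewrite -deriveE//.
have quotE : (fun h : R => h^-1 *: (((fun s : R => phi (z + s *: v)) \o shift r) (h *: (1 : R)) -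
    phi (z + r *: v))) =
  (fun h : R => h^-1 *: ((phi \o shift (z + r *: v)) (h *: v) - phi (z + r *: v))).
  apply/funext => h /=; do 3 congr (_ _).
  rewrite [h *: (1 : R)](_ : _ = h); last by rewrite /GRing.scale/= mulr1.
  by rewrite scalerDl addrCA.
apply: DeriveDef; first by rewrite /derivable quotE; exact: diff_derivable.
by rewrite /derive quotE.
Qed.

Variable phi : R * E -> R.
Hypothesis phi1 : Cb1_time_space phi.

Lemma is_derive_time (s : R) (x : E) : 0 < s ->
  is_derive s (1 : R) (fun r : R => phi (r, x)) ('d phi (s, x) (1, 0)).
Proof.
move=> s0; have [_ dphi _ _] := phi1.
have lineE (r : R) : (0, x) + r *: (1, 0) = (r, x) :> R * E.
  congr pair => /=; last by rewrite scaler0 addr0.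
  by rewrite add0r /GRing.scale /= mulr1.
have := @is_derive_line _ phi (0, x) (1, 0) s; rewrite lineE => /(_ (dphi (s, x) s0)).
by congr is_derive; apply/funext => r; rewrite lineE.
Qed.

Lemma time_derivativeE (s : R) (x : E) : 0 < s ->
  time_derivative phi s x = 'd phi (s, x) (1, 0).
Proof.
move=> s0; rewrite /time_derivative derive1E.
exact: (@derive_val _ _ _ _ _ _ _ (is_derive_time x s0)).
Qed.

Lemma slice_bounded_lipschitz (s : R) : 0 < s ->
  exists M, bounded_lipschitz M (fun y => phi (s, y)).
Proof.
move=> s0; have [[M phiM] dphi [L dphiL] _] := phi1.
exists M; split; first by move=> y; exact: phiM.
exists `|L| => // x y.
have lineE (r : R) : (s, y) + r *: (0, x - y) = (s, y + r *: (x - y)) :> R * E.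
  by congr pair; rewrite /= scaler0 addr0.
have dline (r : R) : is_derive r (1 : R) (fun r : R => phi ((s, y) + r *: (0, x - y)))
    ('d phi ((s, y) + r *: (0, x - y)) (0, x - y)).
  by apply: is_derive_line; rewrite lineE; exact: dphi.
have [c _] := @MVT_segment _ _ _ _ _ ler01 (fun r _ => dline r)
  (derivable_within_continuous (fun r _ => @ex_derive _ _ _ _ _ _ _ (dline r))).
rewrite subr0 mulr1 scale0r scale1r addr0 [(s, y) + _](_ : _ = (s, x)); last first.
  by congr pair; rewrite /= ?addr0// addrC subrK.
move=> ->; rewrite (le_trans (ler_norm _))// (le_trans (dphiL _ _ _))//.
  by rewrite lineE.
have -> : `|(0 : R, x - y)| = `|x - y| by rewrite prod_normE /= normr0 max_r.
by rewrite (le_trans (ler_wpM2r _ (ler_norm L)))// ler_wpM2l// norm_le_enorm.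
Qed.

(** All that the time expansion uses about [phi], stated without its
    differential. *)
Lemma time_derivative_facts :
  [/\ forall (s : R) (y : E), 0 < s ->
        is_derive s (1 : R) (fun r : R => phi (r, y)) (time_derivative phi s y),
      exists2 M, 0 <= M & forall (s : R) (y : E), 0 < s -> `|time_derivative phi s y| <= M &
      forall (t : R) (x : E) (e : R), 0 < t -> 0 < e -> exists2 r : R, 0 < r &
        forall (s : R) (y : E), 0 < s -> `|t - s| < r ->
          (forall i, `|x ord0 i - y ord0 i| < r) ->
          `|time_derivative phi s y - time_derivative phi t x| <= e].
Proof.
have [_ _ [L dphiL] cphi] := phi1.
pose N : R := `|(1 : R, 0 : E)|.
have N0 : 0 <= N by exact: normr_ge0.
split.
- by move=> s y s0; rewrite time_derivativeE//; exact: is_derive_time.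
- exists (`|L| * N); first by rewrite mulr_ge0.
  move=> s y s0; rewrite time_derivativeE//.
  apply: (le_trans (dphiL (s, y) s0 _)).
  by apply: ler_wpM2r => //; exact: ler_norm.
- move=> t x e t0 e0.
  have eN0 : 0 < e / (N + 1) by rewrite divr_gt0// ltr_wpDl.
  have /nbhs_ballP[r /= r0 rphi] := cphi (t, x) t0 _ eN0.
  exists r => // s y s0 ts xy; rewrite !time_derivativeE//.
  have bsy : ball (t, x) r (s, y).
    by split => //=; split => // i j; rewrite (ord1 i); exact: xy.
  apply: (le_trans (rphi (s, y) bsy (1, 0))); rewrite -/N.
  by rewrite mulrAC ler_pdivrMr ?ltr_wpDl// ler_wpM2l ?lerDl// ltW.
Qed.

(** Near [x0] the remainder is controlled by the continuity of the time
    derivative; away from [x0] the crude bound is absorbed by the penalty. *)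
Lemma time_expansion (t : R) (x0 : E) (e : R) : 0 < t -> 0 < e ->
  exists2 b : R, 0 <= b & exists2 h0 : R, 0 < h0 & forall h y, 0 < h -> h < h0 ->
    0 < t - h /\
    `|phi (t - h, y) - phi (t, y) + h * time_derivative phi t x0| <=
      h * (e + b * saturate (y - x0)).
Proof.
have [dphi [M M0 phiM] cphi] := time_derivative_facts.
move: (time_derivative phi) dphi phiM cphi => D dphi phiM cphi.
move=> tgt0 e0; have [r r0 rD] := cphi t x0 e tgt0 e0.
pose k := r ^+ 2 / (1 + r ^+ 2).
have k0 : 0 < k by rewrite divr_gt0 ?exprn_gt0// ltr_wpDr ?sqr_ge0.
pose b := 2 * M / k.
have b0 : 0 <= b by rewrite /b divr_ge0 ?(ltW k0)// mulr_ge0.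
exists b => //; exists (Num.min t r); first by rewrite lt_min tgt0.
move=> h y hgt0; rewrite lt_min => /andP[ht hr].
have th0 : 0 < t - h by rewrite subr_gt0.
split => //.
have dseg s : s \in `]t - h, t[ -> is_derive s (1 : R) (fun r : R => phi (r, y)) (D s y).
  by rewrite in_itv/= => /andP[s0 _]; apply: dphi; exact: lt_trans s0.
have cseg : {within `[t - h, t], continuous (fun r : R => phi (r, y))}.
  apply: derivable_within_continuous => s; rewrite in_itv/= => /andP[s0 _].
  exact: (@ex_derive _ _ _ _ _ _ _ (dphi s y (lt_le_trans th0 s0))).
have thlt : t - h < t by rewrite gtrBl.
have [c + phic] := MVT thlt dseg cseg.
rewrite in_itv/= => /andP[c1 c2].
have c0 : 0 < c by exact: lt_trans c1.
have -> : phi (t - h, y) - phi (t, y) + h * D t x0 = h * (D t x0 - D c y).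
  by rewrite -opprB phic; ring.
rewrite normrM (gtr0_norm hgt0) ler_wpM2l ?(ltW hgt0)//.
have sat0 := saturate_ge0 (y - x0).
have [yx0|/existsNP[i /negP]] := pselect (forall i, `|x0 ord0 i - y ord0 i| < r).
  rewrite distrC (le_trans (rD c y c0 _ yx0))//.
    by rewrite ltr_norml; apply/andP; split; lra.
  by rewrite lerDl mulr_ge0.
rewrite -leNgt distrC => ri.
have := @saturate_far _ _ (y - x0) i r r0; rewrite !mxE -/k => /(_ ri) ks.
rewrite (le_trans (ler_normB _ _))//.
apply: (@le_trans _ _ (2 * M)).
  by have := phiM t x0 tgt0; have := phiM c y c0; lra.
rewrite ler_wpDl// ?(ltW e0)// /b mulrAC ler_pdivlMr//.
by rewrite ler_wpM2l// mulr_ge0.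
Qed.

End TestFunctions.

(** * Consequences of the semigroup property *)

Section Semigroup.
Context {R : realType} {d : nat}.
Local Notation E := 'rV[R]_d.

Lemma mixed_cvg_near (fn : nat -> E -> R) (f : E -> R) (K : set E) (e : R) :
  mixed_cvg fn f -> compact K -> 0 < e ->
  \forall n \near \oo, forall y, K y -> `|f y - fn n y| < e.
Proof.
move=> [_ fnf] Kc e0; have := fnf K Kc.
move=> /(_ [set g : {uniform` K -> R} | forall y, K y -> `|f y - g y| < e]); apply.
apply/uniform_nbhs; exists [set xy : R * R | ball xy.1 e xy.2]; split.
  exact: (entourage_ball _ (PosNum e0)).
by move=> g /= Kg y Ky; exact: Kg.
Qed.

Lemma compact_box (x : E) : compact [set y : E | forall i, `|x ord0 i - y ord0 i| <= 1].
Proof.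
rewrite (_ : [set y | _] = [set y : E | forall i,
    `[x ord0 i - 1, x ord0 i + 1]%classic (y ord0 i)]).
  apply: (@rV_compact _ _ (fun i => `[x ord0 i - 1, x ord0 i + 1]%classic)) => i.
  exact: segment_compact.
apply/seteqP; split => y /= h i; have := h i; rewrite ?in_itv/= ?ler_norml.
  by move=> /andP[h1 h2]; apply/andP; split; lra.
by move=> /andP[h1 h2]; apply/andP; split; lra.
Qed.

Variable S : R -> (E -> R) -> E -> R.
Hypothesis SS : strongly_continuous_monotone_semigroup S.

(** Sequential continuity in time, uniform on compact sets, upgrades to an
    actual neighbourhood of times. *)
Lemma semigroup_time_continuous (f : E -> R) (t : R) (K : set E) (e : R) :
  Cb f -> 0 <= t -> compact K -> 0 < e -> exists2 r : R, 0 < r &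
  forall s y, 0 <= s -> `|t - s| < r -> K y -> `|S t f y - S s f y| < e.
Proof.
move=> fC t_ge0 Kc e0; apply: contrapT => nr.
have /choice[sn snP] : forall n : nat, exists s : R, [/\ 0 <= s, `|t - s| < n.+1%:R^-1 &
    exists2 y, K y & e <= `|S t f y - S s f y|].
  move=> n; apply: contrapT => ns; apply: nr.
  exists n.+1%:R^-1; first by rewrite invr_gt0.
  move=> s y s0 ts Ky; rewrite ltNge; apply/negP => ey; apply: ns.
  by exists s; split => //; exists y.
have snt : sn n @[n --> \oo] --> t.
  apply/cvgrPdist_lt => r r0; near=> n.
  have [_ + _] := snP n => /lt_trans; apply.
  by near: n; exact: (near_infty_natSinv_lt (PosNum r0)).
have sn0 n : 0 <= sn n by have [] := snP n.
have := mixed_cvg_near (semigroup_strongly_continuous SS fC sn0 t_ge0 snt) Kc e0.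
move=> [N _ /(_ N (leqnn N)) /= hN].
by have [_ _ [y Ky]] := snP N; rewrite leNgt (hN y Ky).
Unshelve. all: by end_near. Qed.

Lemma semigroup_Cb_time_space (f : E -> R) (M : R) : Cb f ->
  (forall t x, 0 <= t -> `|S t f x| <= M) ->
  Cb_time_space (fun z : R * E => S z.1 f z.2).
Proof.
move=> fC fM; split; last by exists M => z; exact: fM.
apply/subspace_continuousP => -[t x] /= t_ge0.
apply: (@cvgrPdist_lt _ _ _ (within _ (nbhs (t, x))) _ _ _).2 => e e0.
have e20 : 0 < e / 2 by rewrite divr_gt0.
have [r r0 hr] := semigroup_time_continuous fC t_ge0 (@compact_box x) e20.
have [cS _] := semigroup_Cb SS t_ge0 fC.
have /nbhs_ballP[r' /= r'0 hr'] : \forall y \near x, `|S t f x - S t f y| < e / 2.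
  exact: (@cvgr_dist_lt _ _ _ (nbhs x) (nbhs_filter x) _ _ (cS x)).
apply/nbhs_ballP; exists (Num.min 1 (Num.min r r')) => /=.
  by rewrite !lt_min ltr01 r0 r'0.
move=> [s y] [/= ts xy] s0.
have r1 : Num.min 1 (Num.min r r') <= 1 by rewrite ge_min lexx.
have rr : Num.min 1 (Num.min r r') <= r by rewrite !ge_min lexx orbT.
have rr' : Num.min 1 (Num.min r r') <= r' by rewrite !ge_min lexx !orbT.
have h1 : `|S t f x - S t f y| < e / 2 by apply: hr'; exact: le_ball xy.
have h2 : `|S t f y - S s f y| < e / 2.
  apply: hr => //; first exact: lt_le_trans rr.
  by move=> i; have [_ /(_ ord0 i) /ltW /le_trans] := xy; apply.
rewrite (le_lt_trans (ler_distD (S t f y) _ _))// [ltRHS]splitr.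
exact: ltrD.
Qed.

Lemma generatorP (f : E -> R) : generator_domain S f ->
  is_generator_value S f (generator S f).
Proof. by move=> [_ fg]; rewrite /generator; exact: (getPex fg). Qed.

Lemma generator_near (f : E -> R) (x : E) (e r : R) : generator_domain S f ->
  0 < e -> 0 < r ->
  exists h : R, [/\ 0 < h, h < r & `|generator S f x - (S h f x - f x) / h| < e].
Proof.
move=> fD e0 r0; have [_ gv] := generatorP fD.
pose tn (n : nat) : R := n.+1%:R^-1.
have tn0 n : 0 < tn n by rewrite invr_gt0.
have := mixed_cvg_near (gv tn tn0 cvg_harmonic) (@compact_set1 _ x) e0.
move=> gnear; near \oo => n; exists (tn n); split => //.
  by near: n; exact: (near_infty_natSinv_lt (PosNum r0)).
have : forall y, [set x] y -> `|generator S f y - (S (tn n) f y - f y) / tn n| < e.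
  by near: n.
by apply.
Unshelve. all: by end_near. Qed.

End Semigroup.

(** * Viscosity property *)

Section ViscosityStep.
Context {R : realType} {d : nat} {A : Type}.
Local Notation E := 'rV[R]_d.
Variables (p m : R) (mu : A -> R -> probability (borelRd R d) R) (psi : A -> R -> E -> E).
Hypothesis p_gt1 : 1 < p.
Hypothesis m_ge0 : 0 <= m.
Variable a0 : A.
Hypothesis mu_moment : forall a (t : R), 0 <= t -> finite_moment p (mu a t).
Hypothesis psi_lipschitz : exists2 c : R, 0 <= c &
  forall a (t : R) x1 x2, 0 <= t ->
    enorm (psi a t x1 - psi a t x2) <= expR (c * t) * enorm (x1 - x2).

Lemma Sop_bounded (u : E -> R) (M : R) :
  strongly_continuous_monotone_semigroup (Sop p m mu psi) -> Cb u ->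
  (forall x, `|u x| <= M) ->
  forall (t : R) x, 0 <= t -> `|Sop p m mu psi t u x| <= M.
Proof.
move=> SS uC uM t x t_ge0.
have M0 : 0 <= M by apply: le_trans (uM 0).
have cst_Sop (c : R) : - `|c| <= Sop p m mu psi t (fun=> c) x <= `|c|.
  rewrite -ler_norml.
  exact: (Sop_bound p_gt1 m_ge0 a0 mu_moment psi_lipschitz x t_ge0 (bounded_lipschitz_cst c)).
have cstC (c : R) : Cb (fun=> c : R) := bounded_lipschitz_Cb (bounded_lipschitz_cst c).
rewrite ler_norml; apply/andP; split.
  apply: (@le_trans _ _ (Sop p m mu psi t (fun=> - M) x)).
    by have /andP[+ _] := cst_Sop (- M); rewrite normrN ger0_norm.
  apply: (semigroup_monotone SS) => // y.
  by have := uM y; rewrite ler_norml => /andP[].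
apply: (@le_trans _ _ (Sop p m mu psi t (fun=> M) x)).
  apply: (semigroup_monotone SS) => // y.
  by have := uM y; rewrite ler_norml => /andP[].
by have /andP[_] := cst_Sop M; rewrite ger0_norm.
Qed.

Hypothesis drift : exists2 C : R, 0 < C & forall a (t : R) x, 0 < t ->
  enorm (psi a t x - x) / t <= C * (1 + enorm x).
Hypothesis test_function_growth : forall chi : E -> R, Cc_infty chi ->
  (limf_esup
     (fun t : R => ereal_sup
        [set (`| \int[mu a t]_y ((chi (y : E) - chi 0) / t) |)%:E
        | a in [set: A]])
     (0 : R)^'+ < +oo)%E.

(** The substitute for linearity: shifting a test function back in time by [h]
    commutes with one semigroup step of length [h] up to [o(h)] at [x]. The
    time expansion carries a penalty with coefficient [h * b], which the
    Lyapunov bound turns into an error [h * b * K * h]. *)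
Lemma Sop_time_shift (phi : R * E -> R) (t : R) (x : E) (e : R) :
  0 < t -> Cb1_time_space phi ->
  generator_domain (Sop p m mu psi) (fun y => phi (t, y)) -> 0 < e ->
  exists h : R, [/\ 0 < h, 0 < t - h,
    `|generator (Sop p m mu psi) (fun y => phi (t, y)) x -
      (Sop p m mu psi h (fun y => phi (t, y)) x - phi (t, x)) / h| < e,
    Sop p m mu psi h (fun y => phi (t - h, y)) x <=
      Sop p m mu psi h (fun y => phi (t, y)) x +
      h * (2 * e - time_derivative phi t x) &
    Sop p m mu psi h (fun y => phi (t, y)) x <=
      Sop p m mu psi h (fun y => phi (t - h, y)) x +
      h * (2 * e + time_derivative phi t x)].
Proof.
move=> tgt0 phi1 phiD e0.
have [K K0 [t0 t00 step]] := saturate_one_step test_function_growth p_gt1 m_ge0 drift x.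
have [b b0 [h0 h00 phih]] := time_expansion phi1 x tgt0 e0.
(* The last bound makes the accumulated penalty [b * K * h] smaller than [e]. *)
have r0 : 0 < Num.min t0 (Num.min h0 (e / (b * K + 1))).
  by rewrite !lt_min t00 h00 divr_gt0// ltr_wpDl// mulr_ge0.
have [h [hgt0 + gh]] := generator_near x phiD e0 r0.
rewrite !lt_min => /and3P[ht0 hh0 he].
have bKh : b * (K * h) <= e.
  move: he; rewrite ltr_pdivlMr; last by rewrite ltr_wpDl// mulr_ge0.
  nra.
have [th0 _] := phih h x hgt0 hh0.
have [M1 fb] := slice_bounded_lipschitz phi1 tgt0.
have [M2 gb] := slice_bounded_lipschitz phi1 th0.
have hb0 : 0 <= h * b by rewrite mulr_ge0// ltW.
exists h; split => //.
- apply: (@le_trans _ _ (Sop p m mu psi h (fun y => phi (t, y)) x +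
      (h * (e - time_derivative phi t x) + h * b * (K * h)))).
    apply: (Sop_comparison p_gt1 m_ge0 a0 mu_moment psi_lipschitz K0 step
      (ltW hgt0) (ltW ht0) hb0 gb fb) => y.
    have [_] := phih h y hgt0 hh0.
    by rewrite ler_norml => /andP[_]; lra.
  by rewrite lerD2l -mulrA -mulrDr ler_wpM2l ?(ltW hgt0)//; lra.
- apply: (@le_trans _ _ (Sop p m mu psi h (fun y => phi (t - h, y)) x +
      (h * (e + time_derivative phi t x) + h * b * (K * h)))).
    apply: (Sop_comparison p_gt1 m_ge0 a0 mu_moment psi_lipschitz K0 step
      (ltW hgt0) (ltW ht0) hb0 fb gb) => y.
    have [_] := phih h y hgt0 hh0.
    by rewrite ler_norml => /andP[+ _]; lra.
  by rewrite lerD2l -mulrA -mulrDr ler_wpM2l ?(ltW hgt0)//; lra.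
Qed.

End ViscosityStep.

Theorem theorem3p3 (R : realType) (d : nat) (p m : R) (A : Type)
  (mu : A -> R -> probability (borelRd R d) R)
  (psi : A -> R -> 'rV[R]_d -> 'rV[R]_d)
  (p_gt1 : 1 < p) (m_ge0 : 0 <= m) (A_nonempty : inhabited A)
  (mu_moment : forall a (t : R), 0 <= t -> finite_moment p (mu a t))
  (psi_continuous : forall a (t : R), 0 <= t -> continuous (psi a t))
  (chapman_kolmogorov : forall a (s t : R) (f : 'rV[R]_d -> R) x,
     0 <= s -> 0 <= t -> Cb f ->
     \int[mu a (s + t)]_y f (psi a (s + t) x + (y : 'rV[R]_d)) =
     \int[mu a t]_yt (\int[mu a s]_ys
       f (psi a s (psi a t x + (yt : 'rV[R]_d)) + (ys : 'rV[R]_d))))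
  (hyp1_0 : forall a x, psi a 0 x = x)
  (hyp1 : exists2 C : R, 0 < C & forall a (t : R) x, 0 < t ->
     enorm (psi a t x - x) / t <= C * (1 + enorm x))
  (hyp2 : exists2 c : R, 0 <= c & forall a (t : R) x1 x2, 0 <= t ->
     enorm (psi a t x1 - psi a t x2) <= expR (c * t) * enorm (x1 - x2))
  (hyp3 : forall chi : 'rV[R]_d -> R, Cc_infty chi ->
     (limf_esup
        (fun t : R => ereal_sup
           [set (`| \int[mu a t]_y ((chi (y : 'rV[R]_d) - chi 0) / t) |)%:E
           | a in [set: A]])
        (0 : R)^'+ < +oo)%E)
  (hyp4_0 : forall a (B : set (borelRd R d)), measurable B ->
     mu a 0 B = dirac ((0 : 'rV[R]_d) : borelRd R d) B)
  (hyp4_moment :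
     ereal_sup [set (\int[mu a t]_y (enorm (y : 'rV[R]_d) `^ p)%:E)%E
               | a in [set: A]] @[t --> (0 : R)^'+] --> 0%E)
  (hyp4_tail : forall e : R, 0 < e -> exists2 M : R, 0 < M &
     (ereal_sup
        [set (mu a t [set y : borelRd R d | (M < enorm (y : 'rV[R]_d))%R]
              * (t^-1)%:E)%E
        | a in [set: A] & t in [set t : R | (0 < t)%R]] < e%:E)%E)
  (S_semigroup : strongly_continuous_monotone_semigroup (Sop p m mu psi))
  (D : set ('rV[R]_d -> R)) (D_nonempty : D !=set0)
  (D_sub : D `<=` generator_domain (Sop p m mu psi))
  (u0 : 'rV[R]_d -> R) (u0_Cb : Cb u0) :
  viscosity_solution (generator (Sop p m mu psi)) D u0
    (fun z => Sop p m mu psi z.1 u0 z.2).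
Proof.
case: A_nonempty => a0.
have [M u0M] := u0_Cb.2.
have vM := Sop_bounded p_gt1 m_ge0 a0 mu_moment hyp2 S_semigroup u0_Cb u0M.
have vC := semigroup_Cb_time_space S_semigroup u0_Cb vM.
have v0 x : Sop p m mu psi 0 u0 x = u0 x by rewrite (semigroup_0 S_semigroup u0_Cb).
have shift t x phi (e : R) tgt0 phi1 phiD := @Sop_time_shift _ _ _ _ _ _ _ p_gt1 m_ge0 a0
  mu_moment hyp2 hyp1 hyp3 phi t x e tgt0 phi1 (D_sub _ phiD).
have dpp (t h : R) : 0 < h -> 0 < t - h ->
    Sop p m mu psi h (Sop p m mu psi (t - h) u0) = Sop p m mu psi t u0.
  move=> hgt0 th0; rewrite (semigroup_add S_semigroup) ?ltW//.
  by rewrite addrC subrK.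
have vCb (s : R) : 0 < s -> Cb (Sop p m mu psi s u0).
  by move=> s0; exact: (semigroup_Cb S_semigroup (ltW s0) u0_Cb).
have phiCb (phi : R * 'rV[R]_d -> R) (s : R) : Cb1_time_space phi -> 0 < s ->
    Cb (fun y => phi (s, y)).
  move=> phi1 s0; have [N phib] := slice_bounded_lipschitz phi1 s0.
  exact: bounded_lipschitz_Cb phib.
split; split => // t x phi tgt0 phi1 phiD vphi vle;
  apply/ler_addgt0Pr => e e0; have e30 : 0 < e / 3 by rewrite divr_gt0.
- have [h [hgt0 th0 gh up _]] := shift t x phi _ tgt0 phi1 phiD e30.
  have : phi (t, x) <= Sop p m mu psi h (fun y => phi (t - h, y)) x.
    rewrite -vphi /= -(dpp _ _ hgt0 th0).
    apply: (semigroup_monotone S_semigroup (ltW hgt0)); [exact: vCb|exact: phiCb|].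
    by move=> y; exact: (vle (t - h, y)).
  move=> /le_trans/(_ up) ineq.
  have quot : time_derivative phi t x - 2 * (e / 3) <=
      (Sop p m mu psi h (fun y => phi (t, y)) x - phi (t, x)) / h.
    by rewrite ler_pdivlMr//; lra.
  by move: gh; rewrite ltr_norml => /andP[gh _]; lra.
- have [h [hgt0 th0 gh _ low]] := shift t x phi _ tgt0 phi1 phiD e30.
  have below : Sop p m mu psi h (fun y => phi (t - h, y)) x <= phi (t, x).
    rewrite -vphi /= -(dpp _ _ hgt0 th0).
    apply: (semigroup_monotone S_semigroup (ltW hgt0)); [exact: phiCb|exact: vCb|].
    by move=> y; exact: (vle (t - h, y)).
  have quot : (Sop p m mu psi h (fun y => phi (t, y)) x - phi (t, x)) / h <=
      2 * (e / 3) + time_derivative phi t x.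
    by rewrite ler_pdivrMr//; lra.
  by move: gh; rewrite ltr_norml => /andP[_ gh]; lra.
Qed.
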